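(* Every separable (real or complex) Hilbert space, equipped with the metric induced by its norm, is a metric space of strong negative type.
   Context: A metric space $(\mathcal{X},d)$ is of negative type if $\sum_{i,j=1}^n\alpha_i\alpha_j d(x_i,x_j)\le 0$ for all $n\in\mathbb{N}$, $x_1,\dots,x_n\in\mathcal{X}$ and $\alpha\in\mathbb{R}^n$ with $\sum_i\alpha_i=0$. $M_1^1(\mathcal{X})$ is the set of Borel probability measures $\mu$ on $\mathcal{X}$ with $\int d(x,o)\,d\mu(x)<\infty$ for some (equivalently every) $o\in\mathcal{X}$. For a finite signed Borel measure $\mu$ with $\int d(x,o)\,d|\mu|(x)<\infty$, put $D(\mu)=\int d(x_1,x_2)\,d(\mu\times\mu)(x_1,x_2)$. A metric space of negative type is of strong negative type if for all $\mu_1,\mu_2\in M_1^1(\mathcal{X})$: $D(\mu_1-\mu_2)=0\iff\mu_1=\mu_2$. *)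

(* Defs.v *)
From HB Require Import structures.
From mathcomp Require Import all_boot all_order all_algebra.
From mathcomp Require Import sesquilinear complex.
From mathcomp Require Import all_classical all_reals all_analysis.
Set Implicit Arguments.
Unset Strict Implicit.
Unset Printing Implicit Defensive.
Import Order.TTheory GRing.Theory Num.Theory.
Import numFieldNormedType.Exports.

Local Open Scope classical_set_scope.
Local Open Scope ring_scope.

#[short(type="pmetricType")]
HB.structure Definition PointedMetric (R : numDomainType) :=
  { T of Metric R T & isPointed T }.

Definition separable (T : topologicalType) :=
  exists2 A : set T, countable A & dense A.

Notation borel T := (g_sigma_algebraType (@open T)).

Definition negative_type (R : realType) (T : metricType R) :=
  forall (n : nat) (x : 'I_n -> T) (a : 'I_n -> R),
    \sum_(i < n) a i = 0 ->
    \sum_(i < n) \sum_(j < n) a i * a j * mdist (x i) (x j) <= 0.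

Definition finite_first_moment (R : realType) (T : pmetricType R)
    (mu : probability (borel T) R) :=
  exists o : T, (\int[mu]_(x in setT) (mdist (x : T) o)%:E < +oo)%E.

Section signed_product.
Context d (T : measurableType d) (R : realType).
Implicit Type nu : {charge set T -> \bar R}.

Definition hahn_pos nu : set T := sval (cid (Hahn_decomposition nu)).

Definition hahn_neg nu : set T :=
  sval (cid (svalP (cid (Hahn_decomposition nu)))).

Definition hahn_posneg nu : hahn_decomposition nu (hahn_pos nu) (hahn_neg nu) :=
  svalP (cid (svalP (cid (Hahn_decomposition nu)))).

(* charge_pos nu does not depend on the chosen Hahn decomposition: it is the
   positive part of the Jordan decomposition of nu; same for charge_neg nu. *)
Definition charge_pos nu : {finite_measure set T -> \bar R} :=
  jordan_pos (hahn_posneg nu).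

Definition charge_neg nu : {finite_measure set T -> \bar R} :=
  jordan_neg (hahn_posneg nu).

(* Integral of f with respect to the signed product measure nu * nu, whose
   Jordan decomposition has positive part nu^+ * nu^+ + nu^- * nu^- and
   negative part nu^+ * nu^- + nu^- * nu^+. *)
Definition integral_charge_sqr nu (f : T * T -> \bar R) : \bar R :=
  ((\int[charge_pos nu \x charge_pos nu]_(z in setT) f z
    + \int[charge_neg nu \x charge_neg nu]_(z in setT) f z)
   - (\int[charge_pos nu \x charge_neg nu]_(z in setT) f z
    + \int[charge_neg nu \x charge_pos nu]_(z in setT) f z))%E.

End signed_product.

Definition D (R : realType) (T : pmetricType R)
    (nu : {charge set (borel T) -> \bar R}) : \bar R :=
  integral_charge_sqr nu (fun z => (mdist (z.1 : T) z.2)%:E).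

Definition probability_diff d (T : measurableType d) (R : realType)
    (mu1 mu2 : probability T R) : {charge set T -> \bar R} :=
  cadd (charge_of_finite_measure mu1) (copp (charge_of_finite_measure mu2)).

(* Measures are functions on all subsets, with junk values on non-measurable
   ones; two measures are the same when they agree on the measurable sets. *)
Definition same_measure d (T : measurableType d) (R : realType)
    (mu1 mu2 : probability T R) :=
  forall A : set T, measurable A -> mu1 A = mu2 A.

Definition strong_negative_type (R : realType) (T : pmetricType R) :=
  negative_type T /\
  forall mu1 mu2 : probability (borel T) R,
    finite_first_moment mu1 -> finite_first_moment mu2 ->
    (D (probability_diff mu1 mu2) = 0%E <-> same_measure mu1 mu2).

(* V is a Hilbert space when it is a completeNormedModType and its norm is
   induced by an inner product: theta is idfun over R and conjugation over R[i];
   dot is linear in its first argument and theta-linear in the second. *)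
Definition induces_norm (K : numFieldType) (theta : K -> K)
    (V : normedModType K) (dot : {dot V for theta}) :=
  forall x : V, `|x| ^+ 2 = dot x x.

(* The library puts no metricType structure on an arbitrary normedModType, and
   over R[i] the norm takes its (real) values in R[i]; hence these two aliases,
   which carry the R-valued metric of the norm and the topology it defines. *)
Definition real_metric (R : realType) (V : normedModType R) : Type := V.

Section real_metric.
Context (R : realType) (V : normedModType R).
Let dist (x y : V) : R := `|x - y|.

Let distxx x : dist x x = 0.
Proof. by rewrite /dist subrr normr0. Qed.

Let dist_positivity x y : dist x y = 0 -> x = y.
Proof. by move=> /normr0_eq0/eqP; rewrite subr_eq0 => /eqP. Qed.

Let dist_sym x y : dist x y = dist y x.
Proof. exact: distrC. Qed.

Let dist_triangle y x z : dist x z <= dist x y + dist y z.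
Proof. exact: ler_distD. Qed.

HB.instance Definition _ := Choice.copy (real_metric V) V.
HB.instance Definition _ := isPointed.Build (real_metric V) (0 : V).
HB.instance Definition _ := isMetric.Build R (real_metric V)
  distxx dist_positivity dist_sym dist_triangle.

Lemma real_mdistE (x y : V) : mdist (x : real_metric V) y = `|x - y|.
Proof. by []. Qed.

End real_metric.

Definition complex_metric (R : realType) (V : normedModType R[i]) : Type := V.

Section complex_metric.
Context (R : realType) (V : normedModType R[i]).
Let dist (x y : V) : R := complex.Re `|x - y|.

Let distE x y : (dist x y)%:C%C = `|x - y|.
Proof. by rewrite /dist RRe_real// ger0_real. Qed.

Let distxx x : dist x x = 0.
Proof. by rewrite /dist subrr normr0. Qed.

Let dist_positivity x y : dist x y = 0 -> x = y.
Proof.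
move=> d0; have := distE x y; rewrite d0 => /esym/normr0_eq0/eqP.
by rewrite subr_eq0 => /eqP.
Qed.

Let dist_sym x y : dist x y = dist y x.
Proof. by rewrite /dist distrC. Qed.

Let dist_triangle y x z : dist x z <= dist x y + dist y z.
Proof. by rewrite -lecR rmorphD/= !distE ler_distD. Qed.

HB.instance Definition _ := Choice.copy (complex_metric V) V.
HB.instance Definition _ := isPointed.Build (complex_metric V) (0 : V).
HB.instance Definition _ := isMetric.Build R (complex_metric V)
  distxx dist_positivity dist_sym dist_triangle.

Lemma complex_mdistE (x y : V) :
  (mdist (x : complex_metric V) y)%:C%C = `|x - y|.
Proof. exact: distE. Qed.

End complex_metric.

(* Main.v *)
Require Import Defs.
From HB Require Import structures.
From mathcomp Require Import all_boot all_order all_algebra.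
From mathcomp Require Import sesquilinear complex.
From mathcomp Require Import all_classical all_reals all_analysis.
From mathcomp Require Import measurable_realfun.
From mathcomp Require Import ring lra.
Import Order.TTheory GRing.Theory Num.Theory.
Import numFieldNormedType.Exports.
Set Implicit Arguments.
Unset Strict Implicit.
Unset Printing Implicit Defensive.
Local Open Scope classical_set_scope.
Local Open Scope ring_scope.

(** Write [p] and [q] for the Jordan parts of [mu1 - mu2]; they are finite
    measures of equal mass with finite first moments, and for a kernel [f] on
    [T * T] the integral of [f] against [(p - q) x (p - q)] is called its energy.
    The hypothesis says that the distance has energy [0].

    The distance is a mixture of Gaussian kernels: up to a positive constant,
    [r] is the integral over the real line of
    [(1 - exp (- e^(2v) r^2)) e^(-v)], because the change of variable
    [v := v + ln r] pulls out a factor [r] ([integral_mixE]). In an inner product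
    space Gaussian kernels are positive semidefinite ([psd_gauss_ip]), so summing
    the mixture against weights of total [0] gives negative type
    ([gauss_negative_type]). Integrating it against [(p - q) x (p - q)] writes
    minus the energy of the distance as an integral over [v] of nonnegative
    Gaussian energies, so that almost every Gaussian kernel has energy [0]
    ([ae_energy_gauss_eq0]).

    A positive semidefinite kernel of energy [0] satisfies a Cauchy-Schwarz
    inequality, by which [p] and [q] integrate each of its sections equally
    ([energy_gauss_eq0]); by continuity in the scale, [p] and [q] integrate every
    function [exp (- t d(x, z)^2)] of [x] equally ([gauss_agree1]).

    Finally these functions determine a finite measure on any separable space
    where a product of two of them is a constant multiple of a third one, centred
    at the barycentre ([gauss_mul]): polynomials in one Gaussian approximate the
    indicator of the complement of a ball ([cvg_step_poly]), hence [p] and [q]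
    agree on finite intersections of such complements, on open sets, and on the
    Borel sets ([gauss_determining]).

    Only the two metric consequences of the inner product, semidefiniteness of
    the Gaussian kernels and the barycentre identity, enter the measure theory;
    a complex Hilbert space enters with the real part of its inner product. *)

(** * Positive semidefinite kernels *)

Section psd.
Context {R : realType}.

Lemma cvg_sum (I : Type) (r : seq I) (f : I -> R ^nat) (l : I -> R) :
  (forall i, f i N @[N --> \oo] --> l i) ->
  \sum_(i <- r) f i N @[N --> \oo] --> \sum_(i <- r) l i.
Proof. by move=> fl; apply: cvg_big => //; exact: add_continuous. Qed.

Definition psd (T : Type) (k : T -> T -> R) := forall n (x : 'I_n -> T) (a : 'I_n -> R),
  0 <= \sum_(i < n) \sum_(j < n) a i * a j * k (x i) (x j).

(** The Schur complement at [x0]: its quadratic form at points [x i] with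
    weights [a i] is the form of [k] at these points together with [x0], the
    weight of [x0] being chosen to minimise the result. It turns nonnegativity of
    an energy into a Cauchy-Schwarz inequality. *)
Lemma psd_schur (T : Type) (k : T -> T -> R) (x0 : T) :
  psd k -> (forall x y, k x y = k y x) -> k x0 x0 = 1 ->
  psd (fun x y => k x y - k x x0 * k x0 y).
Proof.
move=> kpsd kC k1 n x a.
pose y (i : 'I_n.+1) := if unlift ord0 i is Some j then x j else x0.
pose s := \sum_(j < n) a j * k (x j) x0.
pose b (i : 'I_n.+1) := if unlift ord0 i is Some j then a j else - s.
have y0 : y ord0 = x0 by rewrite /y unlift_none.
have b0 : b ord0 = - s by rewrite /b unlift_none.
have yS i : y (lift ord0 i) = x i by rewrite /y liftK.
have bS i : b (lift ord0 i) = a i by rewrite /b liftK.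
have := kpsd _ y b.
rewrite big_ord_recl [X in X + _]big_ord_recl y0 b0 k1.
under [X in _ + X + _]eq_bigr do rewrite yS bS.
under [X in _ + _ + X]eq_bigr => i _.
  rewrite big_ord_recl yS bS y0 b0; under eq_bigr do rewrite yS bS; over.
rewrite big_split/= => h.
apply: (le_trans h); rewrite le_eqVlt; apply/orP; left; apply/eqP.
have -> : \sum_(i < n) - s * a i * k x0 (x i) = - s * s.
  by rewrite [in RHS]mulr_sumr; apply: eq_bigr => i _; rewrite kC mulrA.
have -> : \sum_(i < n) a i * - s * k (x i) x0 = - s * s.
  by rewrite [in RHS]mulr_sumr; apply: eq_bigr => i _; ring.
have -> : \sum_(i < n) \sum_(j < n) a i * a j * (k (x i) (x j) - k (x i) x0 * k x0 (x j))
   = \sum_(i < n) \sum_(j < n) a i * a j * k (x i) (x j) - s * s.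
  rewrite {2}/s mulr_sumr -sumrB; apply: eq_bigr => i _.
  rewrite /s mulr_suml -sumrB; apply: eq_bigr => j _.
  by rewrite (kC x0); ring.
by ring.
Qed.

(** Scaling is an arbitrary function so that a complex vector space can be
    restricted to real scalars without a second module structure. *)
Record real_inner (V : zmodType) (sc : R -> V -> V) (ip : V -> V -> R) : Prop := {
  ipC : forall x y, ip x y = ip y x;
  ipDl : forall x y z, ip (x + y) z = ip x z + ip y z;
  ipZl : forall a x y, ip (sc a x) y = a * ip x y;
  ip_ge0 : forall x, 0 <= ip x x;
  ip_eq0 : forall x, ip x x = 0 -> x = 0 }.

Section real_inner.
Context (V : zmodType) (sc : R -> V -> V) (ip : V -> V -> R).
Hypothesis ipP : real_inner sc ip.

Let ipDr x y z : ip z (x + y) = ip z x + ip z y.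
Proof. by rewrite !(ipC ipP z) (ipDl ipP). Qed.

Let ipZr a x y : ip y (sc a x) = a * ip y x.
Proof. by rewrite !(ipC ipP y) (ipZl ipP). Qed.

Let ip0l x : ip 0 x = 0.
Proof. by apply: (addrI (ip 0 x)); rewrite -(ipDl ipP) addr0 addr0. Qed.

Let ipNl x y : ip (- x) y = - ip x y.
Proof. by apply/eqP; rewrite -addr_eq0 -(ipDl ipP) addNr ip0l. Qed.

Let ipNr x y : ip y (- x) = - ip y x.
Proof. by rewrite !(ipC ipP y) ipNl. Qed.

Lemma ip_subE x y : ip (x - y) (x - y) = ip x x + ip y y - 2 * ip x y.
Proof. by rewrite (ipDl ipP) !ipDr !ipNl !ipNr (ipC ipP y x); ring. Qed.

(** The Schur product theorem against a Gram matrix. With [x] replaced by its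
    projection off a vector [u], the Gram matrix loses a rank one term, which
    contributes a value of the form of [M]; this Gram-Schmidt step kills the
    vectors one at a time. *)
Lemma mul_ip_ge0 n (M : 'I_n -> 'I_n -> R) (x : 'I_n -> V) :
  (forall a : 'I_n -> R, 0 <= \sum_(i < n) \sum_(j < n) a i * a j * M i j) ->
  forall a : 'I_n -> R,
    0 <= \sum_(i < n) \sum_(j < n) a i * a j * (M i j * ip (x i) (x j)).
Proof.
move=> M0 a.
(* The induction is on the number of vectors that may still be nonzero. *)
have [m] : exists m, forall i : 'I_n, (m <= i)%N -> x i = 0.
  by exists n => i; rewrite leqNgt ltn_ord.
elim: m x => [|m IH] x x0.
  rewrite big1// => i _; rewrite big1// => j _.
  by rewrite x0// ip0l !mulr0.
have [mn|nm] := ltnP m n; last first.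
  by apply: IH => i im; move: (leq_trans nm im); rewrite leqNgt ltn_ord.
pose im := Ordinal mn; pose u := x im; pose s := ip u u.
have [s0|s0] := eqVneq s 0.
  apply: IH => i; rewrite leq_eqVlt => /predU1P[mi|]; last exact: x0.
  have -> : i = im by exact/val_inj.
  exact: (ip_eq0 ipP).
pose x' i := x i - sc (ip (x i) u / s) u.
have ipx' i j : ip (x' i) (x' j) = ip (x i) (x j) - ip (x i) u * ip (x j) u / s.
  rewrite /x' (ipDl ipP) !ipDr !ipNl !ipNr !(ipZl ipP) !ipZr (ipC ipP u) -/s.
  by field.
have H1 : 0 <= \sum_(i < n) \sum_(j < n) a i * a j * (M i j * ip (x' i) (x' j)).
  apply: IH => i; rewrite leq_eqVlt => /predU1P[mi|mi]; apply: (ip_eq0 ipP).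
    have -> : i = im by exact/val_inj.
    by rewrite ipx' -/u -/s mulfK// subrr.
  by rewrite ipx' x0// !ip0l mul0r mul0r subr0.
have H2 := M0 (fun i => a i * ip (x i) u).
rewrite (_ : \sum_(i < n) _ =
  \sum_(i < n) \sum_(j < n) a i * a j * (M i j * ip (x' i) (x' j)) +
  s^-1 * \sum_(i < n) \sum_(j < n) (a i * ip (x i) u) * (a j * ip (x j) u) * M i j).
  by rewrite addr_ge0// mulr_ge0// invr_ge0 (ip_ge0 ipP).
rewrite mulr_sumr -big_split/=; apply: eq_bigr => i _.
rewrite mulr_sumr -big_split/=; apply: eq_bigr => j _.
by rewrite ipx'; field.
Qed.

Lemma psd_ip_exp k : psd (fun x y => ip x y ^+ k).
Proof.
elim: k => [|k IH] n x a.
  under eq_bigr do under eq_bigr do rewrite expr0 mulr1.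
  under eq_bigr do rewrite -mulr_sumr.
  by rewrite -mulr_suml -expr2 sqr_ge0.
under eq_bigr do under eq_bigr do rewrite exprSr.
by apply: mul_ip_ge0 => b; exact: IH.
Qed.

Lemma psd_expR_ip c : 0 <= c -> psd (fun x y => expR (c * ip x y)).
Proof.
move=> c0 n x a.
pose S N := \sum_(i < n) \sum_(j < n) a i * a j * series (exp_coeff (c * ip (x i) (x j))) N.
have Scvg : S N @[N --> \oo] --> \sum_(i < n) \sum_(j < n) a i * a j * expR (c * ip (x i) (x j)).
  apply: cvg_sum => i; apply: cvg_sum => j.
  by apply: cvgMl_tmp; exact: is_cvg_series_exp_coeff.
rewrite -(cvg_lim _ Scvg)//; apply: limr_ge; first by apply/cvg_ex; eexists; exact: Scvg.
near=> N; rewrite /S.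
rewrite (_ : \sum_(i < n) _ = \sum_(0 <= k < N) c ^+ k / k`!%:R *
    \sum_(i < n) \sum_(j < n) a i * a j * ip (x i) (x j) ^+ k).
  apply: sumr_ge0 => k _; rewrite mulr_ge0//; last exact: psd_ip_exp.
  by rewrite divr_ge0// exprn_ge0.
under eq_bigr do under eq_bigr do rewrite /series/= mulr_sumr.
under eq_bigr do rewrite exchange_big/=.
rewrite exchange_big/=; apply: eq_bigr => k _.
rewrite mulr_sumr; apply: eq_bigr => i _.
rewrite mulr_sumr; apply: eq_bigr => j _.
by rewrite /exp_coeff/= exprMn; ring.
Unshelve. all: by end_near. Qed.

(** [exp (- t |x - y|^2)] is [exp (2 t <x, y>)] rescaled by
    [exp (- t |x|^2)] in each variable. *)
Lemma psd_gauss_ip t : 0 <= t -> psd (fun x y => expR (- (t * ip (x - y) (x - y)))).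
Proof.
move=> t0 n x a.
have := @psd_expR_ip (2 * t) _ n x (fun i => a i * expR (- (t * ip (x i) (x i)))).
rewrite mulr_ge0// => /(_ isT) /le_trans; apply.
rewrite le_eqVlt; apply/orP; left; apply/eqP.
apply: eq_bigr => i _; apply: eq_bigr => j _.
rewrite mulrACA -!mulrA -!expRD; do 2 congr (_ * _); congr expR.
by rewrite ip_subE; ring.
Qed.

(** Completing the square in [w] produces the barycentre of [x] and [y] with
    weights [s] and [t]. *)
Lemma ip_barycentre s t x y : 0 < s -> 0 < t -> exists z c, forall w,
  s * ip (x - w) (x - w) + t * ip (y - w) (y - w) = (s + t) * ip (z - w) (z - w) + c.
Proof.
move=> s0 t0.
pose z := sc (s / (s + t)) x + sc (t / (s + t)) y.
exists z, (s * ip x x + t * ip y y - (s + t) * ip z z) => w.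
rewrite !ip_subE.
have -> : ip z w = (s * ip x w + t * ip y w) / (s + t).
  rewrite /z (ipDl ipP) !(ipZl ipP); field.
  by rewrite gt_eqF// addr_gt0.
by field; rewrite gt_eqF// addr_gt0.
Qed.

End real_inner.
End psd.

(** * The distance as a mixture of Gaussians *)

Section mixture.
Context {R : realType}.
Implicit Types r v t : R.

(** The weight [exp (- v)] makes integration over [v] homogeneous of degree one
    in [r]; the logarithmic parameter [v] turns scaling of [r] into translation. *)
Definition mix r v : R := (1 - expR (- (expR (2 * v) * r ^+ 2))) * expR (- v).

Lemma mix_ge0 r v : 0 <= mix r v.
Proof.
rewrite mulr_ge0 ?expR_ge0// subr_ge0 expR_le1 oppr_le0.
by rewrite mulr_ge0 ?expR_ge0 ?sqr_ge0.
Qed.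

Lemma continuous_mix r : continuous (mix r).
Proof.
move=> v; apply: cvgM; last first.
  apply: (@continuous_comp _ _ _ -%R expR); first exact: opp_continuous.
  exact: continuous_expR.
apply: cvgB; first exact: cvg_cst.
apply: (@continuous_comp _ _ _ (fun v => - (expR (2 * v) * r ^+ 2)) expR).
  apply: cvgN; apply: cvgMr_tmp.
  apply: (@continuous_comp _ _ _ (fun v => 2 * v) expR).
    by apply: cvgMl_tmp.
  exact: continuous_expR.
exact: continuous_expR.
Qed.

Lemma mix_le_expN r v : mix r v <= expR (- v).
Proof. by rewrite /mix ler_piMl ?expR_ge0// gerBl expR_ge0. Qed.

Lemma mix1_le_exp v : mix 1 v <= expR v.
Proof.
rewrite /mix expr1n mulr1.
have -> : expR v = expR (2 * v) * expR (- v).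
  by rewrite -expRD; congr expR; ring.
rewrite ler_wpM2r ?expR_ge0// lerBlDr -lerBlDl.
exact: expR_ge1Dx.
Qed.

Local Notation mu := (@lebesgue_measure R).

Lemma measurable_mix r : measurable_fun setT (mix r).
Proof. exact: continuous_measurable_fun (@continuous_mix r). Qed.

Lemma continuous_expN : continuous (fun x : R => expR (- x)).
Proof.
move=> v; apply: (@continuous_comp _ _ _ -%R expR); first exact: opp_continuous.
exact: continuous_expR.
Qed.

Lemma integral_expN :
  (\int[mu]_(x in `[0%R, +oo[%classic) (expR (- x))%:E = 1)%E.
Proof.
rewrite (@ge0_continuous_FTC2y _ _ (fun x => - expR (- x)) _ 0).
- by rewrite oppr0 expR0 EFinN oppeK add0e.
- by move=> x _; exact: expR_ge0.
- by apply: continuous_subspaceT => x; exact: continuous_expN.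
- by rewrite -oppr0; apply: cvgN; exact: cvgr_expR.
- by move=> x _; exact: ex_derive.
- by apply: cvg_at_right_filter; apply: cvgN; exact: continuous_expN.
- by move=> x _; rewrite derive1E derive_val mulrN1 opprK.
Qed.

(** The integrand is at most [exp (- |v|)]. *)
Lemma integral_mix1_lty : (\int[mu]_v (mix 1 v)%:E < +oo)%E.
Proof.
rewrite -(setUv `]-oo, 0%R]) setCitvl ge0_integral_setU//=; last 3 first.
- apply/measurable_EFinP; exact: measurable_funTS (measurable_mix 1).
- by move=> x _; rewrite lee_fin mix_ge0.
- by rewrite -setCitvl; apply/disj_setPCl.
apply: (@le_lt_trans _ _ (1 + 1)%E); last by rewrite -EFinD ltry.
apply: leeD.
  rewrite -[leRHS]integral_expN -[in leLHS]oppr0 ge0_integration_by_substitutionNy.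
  - apply: ge0_le_integral => //=.
    + by move=> x _; rewrite lee_fin mix_ge0.
    + apply/measurable_EFinP; apply: measurable_funTS.
      exact: (measurableT_comp (measurable_mix 1)
        (@measurable_funN _ _ _ _ id (@measurable_id _ _ _))).
    + apply/measurable_EFinP; apply: measurable_funTS.
      exact: continuous_measurable_fun continuous_expN.
    + by move=> x _; rewrite lee_fin mix1_le_exp.
  - by apply: continuous_subspaceT => x; exact: continuous_mix.
  - by move=> x _; exact: mix_ge0.
rewrite -[leRHS]integral_expN.
apply: (@le_trans _ _ (\int[mu]_(v in `[0%R, +oo[) (mix 1 v)%:E)%E).
  apply: ge0_subset_integral => //=.
  - by apply/measurable_EFinP; exact: measurable_funTS (measurable_mix 1).
  - by move=> x _; rewrite lee_fin mix_ge0.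
  - by apply: subset_itvr; rewrite bnd_simp.
apply: ge0_le_integral => //=.
- by move=> x _; rewrite lee_fin mix_ge0.
- by apply/measurable_EFinP; exact: measurable_funTS (measurable_mix 1).
- apply/measurable_EFinP; apply: measurable_funTS.
  exact: continuous_measurable_fun continuous_expN.
- by move=> x _; rewrite lee_fin mix_le_expN.
Qed.

(** On [0, 1] the integrand is at least [(1 - exp (- 1)) exp (- 1)]. *)
Lemma integral_mix1_gt0 : (0 < \int[mu]_v (mix 1 v)%:E)%E.
Proof.
apply: (@lt_le_trans _ _ (\int[mu]_(v in `[0%R, 1%R]) (((1 - expR (-1)) * expR (-1))%:E))%E).
  rewrite integral_cst//= lebesgue_measure_itv/= lte_fin ltr01.
  rewrite sube0 mule1 lte_fin mulr_gt0 ?expR_gt0// subr_gt0 expR_lt1.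
apply: (@le_trans _ _ (\int[mu]_(v in `[0%R, 1%R]) ((mix 1 v)%:E))%E).
  apply: ge0_le_integral => //=.
  - apply/measurable_EFinP; apply: measurable_funS (measurable_mix 1) => //.
  move=> x; rewrite /= in_itv/= => /andP[x0 x1]; rewrite lee_fin /mix.
  have p y : 0 <= expR y by exact: expR_ge0.
  rewrite ler_pM ?subr_ge0// ?expR_le1 ?oppr_le0//.
  - rewrite lerB// ler_expR lerN2 expr1n mulr1 -[leLHS]expR0 ler_expR.
    by rewrite mulr_ge0.
  - by rewrite ler_expR lerN2.
apply: ge0_subset_integral => //=.
  by apply/measurable_EFinP; exact: measurable_mix.
by move=> x _; rewrite lee_fin mix_ge0.
Qed.

(** Translate [v] by [ln r]. *)
Lemma integral_mixE r : 0 <= r ->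
  (\int[mu]_v (mix r v)%:E = r%:E * \int[mu]_v (mix 1 v)%:E)%E.
Proof.
rewrite le_eqVlt => /predU1P[<-|r0].
  rewrite mul0e; under eq_integral do
    rewrite /mix expr0n/= mulr0 oppr0 expR0 subrr mul0r.
  exact: integral0.
have dF : derive1 (fun x : R => x + ln r) = cst 1.
  apply/funext => z; rewrite derive1E derive_val.
  by rewrite addr0.
rewrite [X in (_ = _ * X)%E](@increasing_ge0_integration_by_substitutionT _ (fun x => x + ln r)).
- rewrite -ge0_integralZl//=.
  + apply: eq_integral => x _; rewrite -EFinM; congr EFin.
    rewrite dF !fctE /mix mulr1 expr1n mulr1 [RHS]mulrCA; congr (_ * _).
    * congr (1 - expR (- _)); rewrite mulrDr expRD; congr (_ * _).
      by rewrite mulr_natl mulr2n expRD lnK// expr2.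
    * by rewrite opprD expRD mulrC [in expR (- ln _)]expRN lnK// mulfVK ?gt_eqF.
  + apply/measurable_EFinP; rewrite dF; apply: continuous_measurable_fun => x.
    apply: cvgM; last exact: cvg_cst.
    apply: (@continuous_comp _ _ _ (fun x => x + ln r) (mix 1)).
      by apply: cvgD; [exact: cvg_id|exact: cvg_cst].
    exact: continuous_mix.
  + by move=> x _; rewrite dF !fctE mulr1 lee_fin mix_ge0.
  + by rewrite lee_fin ltW.
- by move=> x y; rewrite ltrD2r.
- by rewrite dF; exact: cst_continuous.
- by rewrite dF; exact: is_cvg_cst.
- by rewrite dF; exact: is_cvg_cst.
- by [].
- apply/cvgrNyPle => A; near=> x; rewrite -lerBrDr; near: x.
  by apply: nbhs_ninfty_le; exact: num_real.
- apply/cvgryPge => A; near=> x; rewrite -lerBlDr; near: x.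
  by apply: nbhs_pinfty_ge; exact: num_real.
- exact: continuous_mix.
- exact: mix_ge0.
Unshelve. all: by end_near. Qed.

End mixture.

(** * Integrals of bounded measurable functions *)

Section Rintegral_extra.
Context d (T : measurableType d) (R : realType) (mu : {measure set T -> \bar R}).

Lemma integrable_sumR (I : Type) (s : seq I) (f : I -> T -> R) :
  (forall i, mu.-integrable setT (EFin \o f i)) ->
  mu.-integrable setT (EFin \o (fun x => \sum_(i <- s) f i x)).
Proof.
move=> fi; rewrite (_ : _ \o _ = (fun x => \sum_(i <- s) (EFin \o f i) x)%E).
  exact: integrable_sum.
by apply/funext => x /=; rewrite sumEFin.
Qed.

Lemma Rintegral_sum (I : Type) (s : seq I) (f : I -> T -> R) :
  (forall i, mu.-integrable setT (EFin \o f i)) ->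
  \int[mu]_x (\sum_(i <- s) f i x) = \sum_(i <- s) \int[mu]_x f i x.
Proof.
move=> fi; elim: s => [|i s IH].
  rewrite big_nil; under eq_Rintegral do rewrite big_nil.
  by rewrite Rintegral_cst// mul0r.
rewrite big_cons -IH -RintegralD//.
  by apply: eq_Rintegral => x _; rewrite big_cons.
exact: integrable_sumR.
Qed.

Lemma Rintegral_dct (f : (T -> R) ^nat) (g h : T -> R) :
  (forall n, measurable_fun setT (f n)) ->
  (forall x, f n x @[n --> \oo] --> g x) ->
  mu.-integrable setT (EFin \o h) ->
  (forall n x, `|f n x| <= h x) ->
  \int[mu]_x f n x @[n --> \oo] --> \int[mu]_x g x.
Proof.
move=> mf fg hi fh.
have mg : measurable_fun setT g by apply: (measurable_fun_cvg mf) => x _; exact: fg.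
have [|||//||gi _ fgi] := @dominated_convergence _ _ _ mu _ measurableT
    (fun n => EFin \o f n) (EFin \o g) (EFin \o h).
- by move=> n; exact/measurable_EFinP.
- exact/measurable_EFinP.
- by apply: aeW => x _ /=; apply/fine_cvgP; split; [exact: nearW|exact: fg].
- by apply: aeW => x n _ /=; rewrite lee_fin.
apply: fine_cvg; rewrite fineK//; exact: integrable_fin_num.
Qed.

End Rintegral_extra.

Section bounded_measurable.
Context d (T : measurableType d) (R : realType).
Implicit Types (f g : T -> R) (mu : {measure set T -> \bar R}).

Definition bmeas f := measurable_fun setT f /\ exists M, forall x, `|f x| <= M.

Lemma bmeas_integrable mu f : (mu setT < +oo)%E -> bmeas f -> mu.-integrable setT (EFin \o f).
Proof.
move=> muT [mf [M fM]]; apply: measurable_bounded_integrable => //.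
exists M; split; first exact: num_real.
by move=> N MN x _; exact: le_trans (fM x) (ltW MN).
Qed.

Lemma bmeas_cst (c : R) : bmeas (fun=> c).
Proof. by split; [exact: measurable_cst|exists `|c|]. Qed.

Lemma bmeasD f g : bmeas f -> bmeas g -> bmeas (fun x => f x + g x).
Proof.
move=> [mf [M fM]] [mg [N gN]]; split; first exact: measurable_funD.
by exists (M + N) => x; rewrite (le_trans (ler_normD _ _))// lerD.
Qed.

Lemma bmeasM f g : bmeas f -> bmeas g -> bmeas (fun x => f x * g x).
Proof.
move=> [mf [M fM]] [mg [N gN]]; split; first exact: measurable_funM.
by exists (M * N) => x; rewrite normrM ler_pM.
Qed.

Lemma bmeas_indic (A : set T) : measurable A -> bmeas (\1_A : T -> R).
Proof.
move=> mA; split; first exact: measurable_indic.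
by exists 1 => x; rewrite indicE ger0_norm ?ler0n// lern1 leq_b1.
Qed.

Lemma bmeas_sum (I : Type) (s : seq I) (f : I -> T -> R) :
  (forall i, bmeas (f i)) -> bmeas (fun x => \sum_(i <- s) f i x).
Proof.
move=> bf; elim: s => [|i s IH].
  by under eq_fun do rewrite big_nil; exact: bmeas_cst.
by under eq_fun do rewrite big_cons; exact: bmeasD.
Qed.

End bounded_measurable.

(** * Negative type *)

Section negative_type.
Context (R : realType) (T : metricType R).

Definition gauss t (x y : T) : R := expR (- (t * mdist x y ^+ 2)).

Lemma integrable_mix (r : R) : 0 <= r ->
  (@lebesgue_measure R).-integrable setT (EFin \o mix r).
Proof.
move=> r0; apply/integrableP; split; first by apply/measurable_EFinP; exact: measurable_mix.
under eq_integral do rewrite /= ger0_norm ?mix_ge0//.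
by rewrite integral_mixE// lte_mul_pinfty// ?lee_fin// integral_mix1_lty.
Qed.

(** For weights of sum [0], the constant [1] in the mixture contributes nothing,
    so the form of the distance is minus a mixture of Gaussian forms. *)
Lemma gauss_negative_type : (forall t, 0 <= t -> psd (gauss t)) -> negative_type T.
Proof.
move=> gpsd n x a a0.
have imix i j : (@lebesgue_measure R).-integrable setT
    (EFin \o (fun v => - (a i * a j) * mix (mdist (x i) (x j)) v)).
  exact: (@integrableZl _ _ _ _ _ measurableT (- (a i * a j)) _
    (integrable_mix (mdist_ge0 (x i) (x j)))).
pose c := \int[@lebesgue_measure R]_v mix 1 v.
have c0 : 0 < c by rewrite fine_gt0// integral_mix1_gt0 integral_mix1_lty.
have mixE r : 0 <= r -> \int[@lebesgue_measure R]_v mix r v = r * c.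
  move=> r0; rewrite /Rintegral integral_mixE// fineM// ge0_fin_numE.
    exact: integral_mix1_lty.
  by rewrite ltW// integral_mix1_gt0.
rewrite -(pmulr_lle0 _ c0) mulr_suml.
under eq_bigr do rewrite mulr_suml.
rewrite -oppr_ge0 -sumrN.
rewrite (_ : \sum_(i < n) _ = \int[@lebesgue_measure R]_v
    \sum_(i < n) \sum_(j < n) - (a i * a j) * mix (mdist (x i) (x j)) v).
  apply: Rintegral_ge0 => v _.
  have -> : \sum_(i < n) \sum_(j < n) - (a i * a j) * mix (mdist (x i) (x j)) v =
    expR (- v) * \sum_(i < n) \sum_(j < n) a i * a j * gauss (expR (2 * v)) (x i) (x j).
    have aa0 : \sum_(i < n) \sum_(j < n) a i * a j = 0.
      by under eq_bigr do rewrite -mulr_sumr a0 mulr0; rewrite big1.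
    rewrite -[RHS]subr0 -[X in _ - X](mulr0 (expR (- v))) -[X in _ - _ * X]aa0.
    rewrite -mulrBr -sumrB mulr_sumr; apply: eq_bigr => i _.
    rewrite -sumrB mulr_sumr; apply: eq_bigr => j _.
    by rewrite /mix /gauss; ring.
  by rewrite mulr_ge0 ?expR_ge0//; apply: gpsd; exact: expR_ge0.
rewrite Rintegral_sum => [|i].
  apply: eq_bigr => i _; rewrite Rintegral_sum// -sumrN; apply: eq_bigr => j _.
  rewrite RintegralZl//; last by apply: integrable_mix; exact: mdist_ge0.
  by rewrite mixE ?mdist_ge0//; ring.
exact: integrable_sumR.
Qed.
End negative_type.

(** * Measurability in separable metric spaces *)

Section metric_measurability.
Context (R : realType) (T : pmetricType R).

Lemma measurable_fun_ltP d (U : measurableType d) (f : U -> R) :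
  (forall r, measurable [set x | f x < r]) <-> measurable_fun setT f.
Proof.
have E r : f @^-1` `]-oo, r[%classic = [set x | f x < r].
  by apply/seteqP; split => x /=; rewrite in_itv.
split=> mf; last first.
  move=> r; rewrite -E -[X in measurable X]setTI; exact: mf.
move=> mD; apply: (measurability _ (RGenInftyO.measurableE R)) => //.
by move=> _ [_ [r ->] <-]; rewrite setTI E.
Qed.

Lemma ballE (c : T) r : ball c r = [set x | mdist c x < r].
Proof. by rewrite -metricType_numDomainType.ball_mdistE. Qed.

Lemma open_mball (c : T) r : open (ball c r).
Proof.
rewrite openE => x; rewrite ballE /= => cx; rewrite /interior -nbhs_ballE.
exists (r - mdist c x) => /=; first by rewrite subr_gt0.
move=> y; rewrite ballE/= ltrBrDl; apply: le_lt_trans; exact: metric_triangle.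
Qed.

Lemma open_measurable_borel (A : set T) : open A -> measurable (A : set (borel T)).
Proof. by move=> oA; apply: sub_sigma_algebra. Qed.

Lemma measurable_mdistl c :
  measurable_fun [set: borel T] (fun x : borel T => mdist (x : T) c).
Proof.
apply/measurable_fun_ltP => r.
have -> : [set x : T | mdist x c < r] = ball c r.
  by rewrite ballE; apply/seteqP; split => x /=; rewrite metric_sym.
by apply: open_measurable_borel; exact: open_mball.
Qed.

Variable a : nat -> T.
Hypothesis a_dense : forall (x : T) e, 0 < e -> exists n, mdist x (a n) < e.

(** The sigma-algebra on [T * T] is the product one, so continuity alone does not
    give measurability; with a dense sequence, [d x y < r] is the countable union
    over [n] of the conditions [d x (a n) + d y (a n) < r]. *)
Lemma measurable_mdist :
  measurable_fun [set: borel T * borel T] (fun z => mdist (z.1 : T) z.2).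
Proof.
apply/measurable_fun_ltP => r.
have -> : [set z : borel T * borel T | mdist (z.1 : T) z.2 < r] =
    \bigcup_n [set z | mdist (z.1 : T) (a n) + mdist (z.2 : T) (a n) < r].
  apply/seteqP; split => [[x y] /= xyr|[x y] [n _]/=]; last first.
    by apply: le_lt_trans; rewrite [mdist y _]metric_sym metric_triangle.
  have e0 : 0 < (r - mdist (x : T) y) / 2 by rewrite divr_gt0// subr_gt0.
  have [n xn] := a_dense x e0.
  exists n => //=.
  have := metric_triangle (y : T) x (a n); rewrite (metric_sym (y : T) x).
  lra.
apply: bigcupT_measurable => n /=.
have : measurable_fun setT (fun z : borel T * borel T =>
    mdist (z.1 : T) (a n) + mdist (z.2 : T) (a n)).
  apply: measurable_funD.
    exact: measurableT_comp (measurable_mdistl _) measurable_fst.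
  exact: measurableT_comp (measurable_mdistl _) measurable_snd.
by move=> /measurable_fun_ltP; exact.
Qed.

(** [a (near_idx n x)] is the point nearest to [x] among [a 0], ..., [a n], ties
    going to the smallest index. As a function of [x] it takes finitely many
    values and converges pointwise to [x], so it discretises measures. *)
Fixpoint near_idx n (x : T) : nat :=
  if n is n'.+1 then
    let i := near_idx n' x in if mdist x (a n) < mdist x (a i) then n else i
  else 0%N.

Lemma near_idx_le n x : (near_idx n x <= n)%N.
Proof. by elim: n => //= n IH; case: ifP => // _; exact: leqW. Qed.

Lemma near_idx_min n x m : (m <= n)%N -> mdist x (a (near_idx n x)) <= mdist x (a m).
Proof.
elim: n => /= [|n IH]; first by rewrite leqn0 => /eqP ->.
rewrite leq_eqVlt ltnS => /predU1P[->|/IH h]; case: ltP => // h'.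
exact: le_trans (ltW h') h.
Qed.

Lemma near_idx_cvg x : mdist x (a (near_idx n x)) @[n --> \oo] --> 0.
Proof.
apply/cvgrPdist_lt => e e0; have [m xm] := a_dense x e0.
near=> n; rewrite sub0r normrN ger0_norm ?mdist_ge0//.
apply: le_lt_trans xm; apply: near_idx_min; near: n.
exact: nbhs_infty_ge.
Unshelve. all: by end_near. Qed.

Lemma measurable_near_idx n i : measurable ([set x | near_idx n x = i] : set (borel T)).
Proof.
elim: n i => [|n IH] i.
  have [<-|/eqP i0] := eqVneq 0%N i.
    by rewrite (_ : [set _ | _] = setT)//; exact/seteqP.
  by rewrite (_ : [set _ | _] = set0)//; apply/seteqP; split => x.
pose L j := [set x : borel T | mdist (x : T) (a n.+1) < mdist (x : T) (a j)].
have mL j : measurable (L j).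
  rewrite /L (_ : [set _ | _] = [set x : borel T |
      mdist (x : T) (a n.+1) - mdist (x : T) (a j) < 0]); last first.
    by apply/seteqP; split => x /=; rewrite subr_lt0.
  have : measurable_fun setT (fun x : borel T =>
      mdist (x : T) (a n.+1) - mdist (x : T) (a j)).
    by apply: measurable_funB; exact: measurable_mdistl.
  by move=> /measurable_fun_ltP; exact.
have -> : [set x | near_idx n.+1 x = i] =
    \bigcup_j ([set x | near_idx n x = j] `&`
      ((L j `&` [set x | n.+1 = i]) `|` (~` L j `&` [set x | j = i]))).
  apply/seteqP; split => x /=.
    case: ifPn => h <-; exists (near_idx n x) => //=; split => //.
      by left.
    by right; split=> //; exact/negP.
  by move=> [j _ [<-]] [[-> ->]//|[/negP/negbTE -> ->]].
apply: bigcupT_measurable => j; apply: measurableI; first exact: IH.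
have mP (P : Prop) : measurable [set _ : borel T | P].
  have [p|p] := pselect P.
    by rewrite (_ : [set _ | _] = setT)//; apply/seteqP; split => x.
  by rewrite (_ : [set _ | _] = set0)//; apply/seteqP; split => x.
by apply: measurableU; apply: measurableI => //; exact: measurableC.
Qed.

End metric_measurability.

(** * Energy of a difference of measures *)

Section bilinear_integral.
Context d (T : measurableType d) (R : realType).
Implicit Types (mu nu p q : {finite_measure set T -> \bar R}) (f g : T * T -> R).

Lemma finite_measure_lty mu : (mu setT < +oo)%E.
Proof. exact: fin_num_fun_lty. Qed.

Lemma product_finite mu nu : ((mu \x nu)%E setT < +oo)%E.
Proof.
rewrite -setXTT product_measure1E//.
by rewrite lte_mul_pinfty ?fin_num_measure ?finite_measure_lty.
Qed.

(** A name for the product measure, to carry its finite measure structure. *)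
Definition finite_prod mu nu := (mu \x nu)%E.

HB.instance Definition _ mu nu := Measure.on (finite_prod mu nu).

Let finite_prod_fin mu nu : fin_num_fun (finite_prod mu nu).
Proof. by apply: lty_fin_num_fun; exact: product_finite. Qed.

HB.instance Definition _ mu nu :=
  @Measure_isFinite.Build _ _ _ (finite_prod mu nu) (@finite_prod_fin mu nu).

Definition prod_int mu nu f : R := \int[(mu \x nu)%E]_z f z.

Lemma bmeas_fst (f : T -> R) : bmeas f -> bmeas (fun z : T * T => f z.1).
Proof.
by move=> [mf [M fM]]; split; [exact: measurableT_comp mf measurable_fst|exists M].
Qed.

Lemma bmeas_snd (f : T -> R) : bmeas f -> bmeas (fun z : T * T => f z.2).
Proof.
by move=> [mf [M fM]]; split; [exact: measurableT_comp mf measurable_snd|exists M].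
Qed.

Lemma prod_int_prod mu nu (f g : T -> R) : bmeas f -> bmeas g ->
  prod_int mu nu (fun z => f z.1 * g z.2) = (\int[mu]_x f x) * (\int[nu]_x g x).
Proof.
move=> bf bg; rewrite /prod_int.
have fi : mu.-integrable setT (EFin \o f).
  exact: bmeas_integrable (finite_measure_lty _) bf.
have gi : nu.-integrable setT (EFin \o g).
  exact: bmeas_integrable (finite_measure_lty _) bg.
rewrite /Rintegral -integral12_prod_meas1; last first.
  apply: bmeas_integrable; first exact: product_finite.
  by apply: bmeasM; [exact: bmeas_fst|exact: bmeas_snd].
rewrite /fubini_F/=.
under eq_integral => x _.
  rewrite (_ : \int[nu]_y _ = (f x)%:E * (\int[nu]_y (g y)%:E))%E; last first.
    by under eq_integral do rewrite EFinM; rewrite integralZl.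
  over.
rewrite -fineM; [|exact: integrable_fin_num..].
by rewrite -(fineK (integrable_fin_num measurableT gi)) integralZr.
Qed.

(** The integral of [f] against the signed measure [(p - q) x (p - q)]. *)
Definition energy p q f := prod_int p p f + prod_int q q f - prod_int p q f - prod_int q p f.

Lemma energyB p q f g : bmeas f -> bmeas g ->
  energy p q (fun z => f z - g z) = energy p q f - energy p q g.
Proof.
move=> bf bg.
have B mu nu : prod_int mu nu (fun z => f z - g z) = prod_int mu nu f - prod_int mu nu g.
  by rewrite /prod_int RintegralB//; apply: bmeas_integrable => //; exact: product_finite.
by rewrite /energy !B; ring.
Qed.

Lemma energy_prod p q (f g : T -> R) : bmeas f -> bmeas g ->
  energy p q (fun z => f z.1 * g z.2) =
  (\int[p]_x f x - \int[q]_x f x) * (\int[p]_x g x - \int[q]_x g x).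
Proof. by move=> bf bg; rewrite /energy !prod_int_prod//; ring. Qed.

Lemma energy_sum p q (I : Type) (s : seq I) (f : I -> T * T -> R) :
  (forall i, bmeas (f i)) ->
  energy p q (fun z => \sum_(i <- s) f i z) = \sum_(i <- s) energy p q (f i).
Proof.
move=> bf.
have B mu nu : prod_int mu nu (fun z => \sum_(i <- s) f i z) = \sum_(i <- s) prod_int mu nu (f i).
  by apply: Rintegral_sum => i; apply: bmeas_integrable => //; exact: product_finite.
by rewrite /energy !B -big_split/= -!sumrB.
Qed.

Lemma energy_cvg p q (f : (T * T -> R) ^nat) g M :
  (forall n, measurable_fun setT (f n)) -> (forall n z, `|f n z| <= M) ->
  (forall z, f n z @[n --> \oo] --> g z) ->
  energy p q (f n) @[n --> \oo] --> energy p q g.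
Proof.
move=> mf fM fg.
have B mu nu : prod_int mu nu (f n) @[n --> \oo] --> prod_int mu nu g.
  apply: (@Rintegral_dct _ _ _ _ _ _ (fun=> M)) => //.
  by apply: bmeas_integrable; [exact: product_finite|exact: bmeas_cst].
by apply: cvgB; [apply: cvgB; [exact: cvgD|]|].
Qed.

End bilinear_integral.

Section psd_energy.
Context (R : realType) (T : pmetricType R).
Variable a : nat -> T.
Hypothesis a_dense : forall (x : T) e, 0 < e -> exists n, mdist x (a n) < e.
Implicit Types (p q : {finite_measure set (borel T) -> \bar R}) (k : T -> T -> R).

Definition seq_continuous2 k := forall (x y : T) (u v : nat -> T),
  mdist x (u n) @[n --> \oo] --> 0 -> mdist y (v n) @[n --> \oo] --> 0 ->
  k (u n) (v n) @[n --> \oo] --> k x y.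

(** Moving each point to the nearest of [a 0], ..., [a n] turns the energy into
    the quadratic form of [k] at these points, with weight the difference of the
    masses that [p] and [q] give to the cells; [n] tends to infinity by dominated
    convergence. *)
Lemma energy_psd_ge0 p q k M : psd k -> seq_continuous2 k ->
  (forall x y, `|k x y| <= M) -> 0 <= energy p q (fun z => k z.1 z.2).
Proof.
move=> kpsd kc kM.
pose A n i : set (borel T) := [set x | near_idx a n x = i].
pose kn n (z : borel T * borel T) := k (a (near_idx a n z.1)) (a (near_idx a n z.2)).
have mA n i : measurable (A n i) by exact: measurable_near_idx.
have knE n : kn n = (fun z => \sum_(i < n.+1) \sum_(j < n.+1)
    (k (a i) (a j) * \1_(A n i) z.1) * \1_(A n j) z.2).
  apply/funext => -[x y]; rewrite /kn/=.
  have xn : (near_idx a n x < n.+1)%N by rewrite ltnS near_idx_le.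
  have yn : (near_idx a n y < n.+1)%N by rewrite ltnS near_idx_le.
  rewrite (bigD1 (Ordinal xn))//= (bigD1 (Ordinal yn))//=.
  rewrite !indicE !mem_set//= !mulr1 big1 ?addr0; last first.
    move=> j jy; rewrite indicE memNset ?mulr0// => yj.
    by move/eqP : jy; apply; exact/val_inj.
  rewrite big1 ?addr0// => i ix; rewrite big1// => j _.
  rewrite indicE memNset ?mulr0 ?mul0r// => xi.
  by move/eqP : ix; apply; exact/val_inj.
have bkn n (i j : 'I_n.+1) : bmeas (fun z : borel T * borel T =>
    (k (a i) (a j) * \1_(A n i) z.1) * \1_(A n j) z.2).
  apply: bmeasM; last exact/bmeas_snd/bmeas_indic.
  by apply: bmeasM; [exact: bmeas_cst|exact/bmeas_fst/bmeas_indic].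
have Ekn n : 0 <= energy p q (kn n).
  rewrite knE energy_sum => [|i]; last exact: bmeas_sum.
  pose m i := \int[p]_x \1_(A n i) x - \int[q]_x \1_(A n i) x.
  have := kpsd n.+1 (fun i => a i) (fun i => m i).
  congr (0 <= _); apply: eq_bigr => i _; rewrite energy_sum//.
  apply: eq_bigr => j _; rewrite (energy_prod p q (f := fun x => k (a i) (a j) * \1_(A n i) x)).
  - rewrite !RintegralZl//; last 2 first.
    + by apply: bmeas_integrable; [exact: finite_measure_lty|exact: bmeas_indic].
    + by apply: bmeas_integrable; [exact: finite_measure_lty|exact: bmeas_indic].
    by rewrite /m; ring.
  - by apply: bmeasM; [exact: bmeas_cst|exact: bmeas_indic].
  - exact: bmeas_indic.
have cv : energy p q (kn n) @[n --> \oo] --> energy p q (fun z => k z.1 z.2).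
  apply: (@energy_cvg _ _ _ _ _ _ _ M).
  - by move=> n; rewrite knE; apply: (bmeas_sum _ _).1 => i; exact: bmeas_sum.
  - by move=> n z; exact: kM.
  - by move=> z; apply: kc; exact: near_idx_cvg.
rewrite -(cvg_lim _ cv)//; apply: limr_ge; first by apply/cvg_ex; eexists; exact: cv.
exact: nearW.
Qed.

End psd_energy.

(** * Energy of Gaussian kernels *)

Section gauss_energy.
Context (R : realType) (T : pmetricType R).
Variable a : nat -> T.
Hypothesis a_dense : forall (x : T) e, 0 < e -> exists n, mdist x (a n) < e.
Implicit Types (p q mu nu : {finite_measure set (borel T) -> \bar R}).

Lemma gauss_ge0 t (x y : T) : 0 <= gauss t x y. Proof. exact: expR_ge0. Qed.

Lemma gauss_le1 t (x y : T) : 0 <= t -> gauss t x y <= 1.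
Proof. by move=> t0; rewrite expR_le1 oppr_le0 mulr_ge0// sqr_ge0. Qed.

Lemma normr_gauss t (x y : T) : 0 <= t -> `|gauss t x y| <= 1.
Proof. by move=> t0; rewrite ger0_norm ?gauss_ge0// gauss_le1. Qed.

Lemma gaussC t (x y : T) : gauss t x y = gauss t y x.
Proof. by rewrite /gauss metric_sym. Qed.

Lemma gaussxx t (x : T) : gauss t x x = 1.
Proof. by rewrite /gauss mdistxx expr0n mulr0 oppr0 expR0. Qed.

Lemma cvg_mdist (x y : T) (u v : nat -> T) :
  mdist x (u n) @[n --> \oo] --> 0 -> mdist y (v n) @[n --> \oo] --> 0 ->
  mdist (u n) (v n) @[n --> \oo] --> mdist x y.
Proof.
move=> xu yv; apply/cvgrPdist_le => e e0.
have : mdist x (u n) + mdist y (v n) @[n --> \oo] --> (0 + 0 : R) by exact: cvgD.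
rewrite addr0 => /cvgrPdist_le /(_ _ e0).
apply: filterS => n /=; rewrite sub0r normrN ger0_norm ?addr_ge0 ?mdist_ge0//.
move=> xye; rewrite ler_norml.
have h1 := metric_triangle x (u n) y; have h2 := metric_triangle (u n) (v n) y.
have h3 := metric_triangle (u n) x (v n); have h4 := metric_triangle x y (v n).
rewrite (metric_sym (v n) y) in h2; rewrite (metric_sym (u n) x) in h3.
lra.
Qed.

Lemma gauss_seq_continuous t : seq_continuous2 (@gauss R T t).
Proof.
move=> x y u v xu yv; rewrite /gauss.
apply: continuous_cvg; first exact: continuous_expR.
by apply: cvgN; apply: cvgMl_tmp; apply: cvgM; exact: cvg_mdist.
Qed.

Lemma measurable_gaussT d (U : measurableType d) (f : U -> R) t :
  measurable_fun setT f -> measurable_fun setT (fun x => expR (- (t * f x ^+ 2))).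
Proof.
move=> mf; apply: measurableT_comp => //; apply: measurable_funN.
by apply: measurable_funM => //; exact: measurable_funX.
Qed.

Lemma bmeas_gauss2 t : 0 <= t ->
  bmeas (fun z : borel T * borel T => gauss t (z.1 : T) z.2).
Proof.
move=> t0; split; last by exists 1 => z; exact: normr_gauss.
by apply: measurable_gaussT; exact: measurable_mdist a_dense.
Qed.

Lemma bmeas_gauss t c : 0 <= t -> bmeas (fun x : borel T => gauss t (x : T) c).
Proof.
move=> t0; split; last by exists 1 => z; exact: normr_gauss.
by apply: measurable_gaussT; exact: measurable_mdistl.
Qed.

Hypothesis gauss_psd : forall t, 0 <= t -> psd (@gauss R T t).

Lemma energy_gauss_ge0 p q t : 0 <= t -> 0 <= energy p q (fun z => gauss t (z.1 : T) z.2).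
Proof.
move=> t0; apply: (energy_psd_ge0 a_dense p q (gauss_psd t0) (@gauss_seq_continuous t) (M := 1)).
by move=> x y; exact: normr_gauss.
Qed.

(** The energy of the Schur complement of a kernel is the energy of the kernel
    minus the square of the difference of the two integrals. *)
Lemma energy_gauss_eq0 p q t x0 : 0 <= t ->
  energy p q (fun z => gauss t (z.1 : T) z.2) = 0 ->
  \int[p]_x gauss t (x : T) x0 = \int[q]_x gauss t (x : T) x0.
Proof.
move=> t0 E0.
pose k (x y : T) := gauss t x y - gauss t x x0 * gauss t x0 y.
have kc : seq_continuous2 k.
  have x0x0 : mdist x0 ((fun=> x0 : T) n) @[n --> \oo] --> 0 by rewrite mdistxx; exact: cvg_cst.
  move=> x y u v xu yv; apply: cvgB; first exact: gauss_seq_continuous.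
  apply: cvgM; first exact: (gauss_seq_continuous xu x0x0).
  exact: (gauss_seq_continuous x0x0 yv).
have kM x y : `|k x y| <= 1 + 1.
  rewrite (le_trans (ler_normB _ _))// lerD ?normr_gauss// normrM.
  by rewrite mulr_ile1 ?normr_gauss.
have := energy_psd_ge0 a_dense p q (psd_schur (gauss_psd t0) (gaussC t) (gaussxx t x0)) kc kM.
rewrite /k.
rewrite (_ : (fun z : borel T * borel T => _) = (fun z => gauss t (z.1 : T) z.2 -
   gauss t (z.1 : T) x0 * gauss t (z.2 : T) x0)); last first.
  by apply/funext => z; rewrite (gaussC t x0).
have bg := bmeas_gauss x0 t0.
rewrite energyB ?E0 ?sub0r; [|exact: bmeas_gauss2|exact: (bmeasM (bmeas_fst bg) (bmeas_snd bg))].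
rewrite (energy_prod p q bg bg) oppr_ge0 -expr2 => h.
by apply/eqP; rewrite -subr_eq0 -sqrf_eq0 eq_le h sqr_ge0.
Qed.

End gauss_energy.

(** * From the distance to Gaussian kernels *)

Section mixture_energy.
Context (R : realType) (T : pmetricType R).
Variable a : nat -> T.
Hypothesis a_dense : forall (x : T) e, 0 < e -> exists n, mdist x (a n) < e.
Implicit Types (p q mu nu : {finite_measure set (borel T) -> \bar R}).
Local Notation lambda := (@lebesgue_measure R).

Let dist2 (z : borel T * borel T) : R := mdist (z.1 : T) z.2.

Definition mean_dist mu nu : \bar R := (\int[(mu \x nu)%E]_z (dist2 z)%:E)%E.

Lemma bmeas_mix2 v : bmeas (fun z : borel T * borel T => mix (dist2 z) v).
Proof.
split; last by exists (expR (- v)) => z; rewrite ger0_norm ?mix_ge0// mix_le_expN.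
apply: measurable_funM => //; apply: measurable_funB => //.
by apply: measurable_gaussT; exact: measurable_mdist a_dense.
Qed.

Lemma measurable_mix_pair : measurable_fun [set: (borel T * borel T) * R]
  (fun w : (borel T * borel T) * R => mix (dist2 w.1) w.2).
Proof.
have m1 : measurable_fun setT (fun w : (borel T * borel T) * R => dist2 w.1).
  by apply: measurableT_comp measurable_fst; exact: measurable_mdist a_dense.
have m2 : measurable_fun setT (fun w : (borel T * borel T) * R => w.2) by exact: measurable_snd.
apply: measurable_funM; last first.
  by apply: measurableT_comp => //; exact: measurable_funN.
apply: measurable_funB => //; apply: measurableT_comp => //; apply: measurable_funN.
apply: measurable_funM; last exact: measurable_funX.
by apply: measurableT_comp => //; exact: measurable_funM.
Qed.

Lemma prod_int_mix_ge0 mu nu v : 0 <= prod_int mu nu (fun z => mix (dist2 z) v).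
Proof. by apply: Rintegral_ge0 => z _; exact: mix_ge0. Qed.

(** Tonelli's theorem on [(T * T) * R]. *)
Lemma integral_prod_int_mix mu nu :
  (\int[lambda]_v (prod_int mu nu (fun z => mix (dist2 z) v))%:E =
   mean_dist mu nu * \int[lambda]_v (mix 1 v)%:E)%E.
Proof.
have f0 (w : (borel T * borel T) * R) : (0 <= (mix (dist2 w.1) w.2)%:E)%E.
  by rewrite lee_fin mix_ge0.
have mf : measurable_fun setT (fun w : (borel T * borel T) * R => (mix (dist2 w.1) w.2)%:E).
  by apply/measurable_EFinP; exact: measurable_mix_pair.
transitivity (\int[lambda]_v \int[(mu \x nu)%E]_z (mix (dist2 z) v)%:E)%E.
  apply: eq_integral => v _; rewrite /prod_int /Rintegral fineK//.
  apply: integrable_fin_num => //; apply: bmeas_integrable; first exact: product_finite.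
  exact: bmeas_mix2.
transitivity (\int[(mu \x nu)%E]_z \int[lambda]_v (mix (dist2 z) v)%:E)%E.
  exact: (esym (@fubini_tonelli _ _ _ _ _ (finite_prod mu nu) lambda _ mf f0)).
under eq_integral do rewrite integral_mixE ?mdist_ge0//.
rewrite ge0_integralZr//=.
- by apply/measurable_EFinP; exact: measurable_mdist a_dense.
- by move=> z _; rewrite lee_fin mdist_ge0.
- by rewrite ltW// integral_mix1_gt0.
Qed.

Lemma measurable_prod_int_mix mu nu :
  measurable_fun setT (fun v => prod_int mu nu (fun z => mix (dist2 z) v)).
Proof.
apply/measurable_EFinP.
have f0 (w : (borel T * borel T) * R) : (0 <= (mix (dist2 w.1) w.2)%:E)%E.
  by rewrite lee_fin mix_ge0.
have mf : measurable_fun setT (fun w : (borel T * borel T) * R => (mix (dist2 w.1) w.2)%:E).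
  by apply/measurable_EFinP; exact: measurable_mix_pair.
rewrite [X in measurable_fun _ X](_ : _ = (fun v => \int[(mu \x nu)%E]_z (mix (dist2 z) v)%:E)%E).
  exact: (@measurable_fun_fubini_tonelli_G _ _ _ _ _ (finite_prod mu nu) _ mf f0).
apply/funext => v /=; rewrite /prod_int /Rintegral fineK//.
apply: integrable_fin_num => //; apply: bmeas_integrable; first exact: product_finite.
exact: bmeas_mix2.
Qed.

Lemma integrable_prod_int_mix mu nu : (mean_dist mu nu < +oo)%E ->
  lambda.-integrable setT (EFin \o (fun v => prod_int mu nu (fun z => mix (dist2 z) v))).
Proof.
move=> fin; apply/integrableP; split.
  by apply/measurable_EFinP; exact: measurable_prod_int_mix.
under eq_integral do rewrite /= ger0_norm ?prod_int_mix_ge0//.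
rewrite integral_prod_int_mix lte_mul_pinfty ?integral_mix1_lty//.
  by apply: integral_ge0 => z _; rewrite lee_fin mdist_ge0.
rewrite ge0_fin_numE//; by apply: integral_ge0 => z _; rewrite lee_fin mdist_ge0.
Qed.

Hypothesis gauss_psd : forall t, 0 <= t -> psd (@gauss R T t).

(** The constant kernel has energy [0] because the masses agree. *)
Lemma energy_mix p q v : \int[p]_x 1 = \int[q]_x 1 ->
  energy p q (fun z => mix (dist2 z) v) =
  - (expR (- v) * energy p q (fun z => gauss (expR (2 * v)) (z.1 : T) z.2)).
Proof.
move=> pq1.
have bg : bmeas (fun z : borel T * borel T => gauss (expR (2 * v)) (z.1 : T) z.2).
  by apply: bmeas_gauss2 a_dense _ _; exact: expR_ge0.
have b1 := @bmeas_cst _ (borel T) R.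
have E1 : energy p q (fun z => expR (- v) * 1) = 0.
  by rewrite (energy_prod p q (b1 (expR (- v))) (b1 1)) pq1 subrr mulr0.
rewrite (_ : (fun z => mix (dist2 z) v) = (fun z => expR (- v) * 1 -
    expR (- v) * gauss (expR (2 * v)) (z.1 : T) z.2)); last first.
  by apply/funext => z; rewrite /mix /gauss /dist2; ring.
rewrite energyB; [|exact: bmeas_cst|exact: (bmeasM (@bmeas_cst _ _ _ (expR (- v))) bg)].
rewrite E1 sub0r; congr (- _).
have Z mu nu :
    prod_int mu nu (fun z => expR (- v) * gauss (expR (2 * v)) (z.1 : T) z.2) =
    expR (- v) * prod_int mu nu (fun z => gauss (expR (2 * v)) (z.1 : T) z.2).
  by rewrite /prod_int RintegralZl//; apply: bmeas_integrable => //; exact: product_finite.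
by rewrite /energy !Z; ring.
Qed.

(** The functions of [v] obtained from the mixture are nonnegative Gaussian
    energies and integrate to a multiple of the energy of the distance. *)
Lemma ae_energy_gauss_eq0 p q : \int[p]_x 1 = \int[q]_x 1 ->
  (mean_dist p p < +oo)%E -> (mean_dist q q < +oo)%E ->
  (mean_dist p q < +oo)%E -> (mean_dist q p < +oo)%E ->
  ((mean_dist p p + mean_dist q q) - (mean_dist p q + mean_dist q p) = 0)%E ->
  {ae lambda, forall v, energy p q (fun z => gauss (expR (2 * v)) (z.1 : T) z.2) = 0}.
Proof.
move=> pq1 ppf qqf pqf qpf D0.
pose G v := - energy p q (fun z => mix (dist2 z) v).
have G0 v : 0 <= G v.
  rewrite /G energy_mix// opprK mulr_ge0 ?expR_ge0//.
  by apply: (energy_gauss_ge0 a_dense gauss_psd); exact: expR_ge0.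
have mG : measurable_fun setT G.
  apply: measurable_funN; apply: measurable_funB; last exact: measurable_prod_int_mix.
  apply: measurable_funB; last exact: measurable_prod_int_mix.
  by apply: measurable_funD; exact: measurable_prod_int_mix.
pose H mu nu v := prod_int mu nu (fun z => mix (dist2 z) v).
have HE mu nu : (mean_dist mu nu < +oo)%E ->
    \int[lambda]_v H mu nu v = fine (mean_dist mu nu) * \int[lambda]_v mix 1 v.
  move=> fin; rewrite /Rintegral integral_prod_int_mix fineM//.
    rewrite ge0_fin_numE//; by apply: integral_ge0 => z _; rewrite lee_fin mdist_ge0.
  by rewrite ge0_fin_numE ?integral_mix1_lty// ltW// integral_mix1_gt0.
have Hi mu nu : (mean_dist mu nu < +oo)%E -> lambda.-integrable setT (EFin \o H mu nu).
  exact: integrable_prod_int_mix.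
have Gi1 : lambda.-integrable setT (EFin \o (fun v => H p q v + H q p v)).
  exact: (integrableD measurableT (Hi _ _ pqf) (Hi _ _ qpf)).
have Gi2 : lambda.-integrable setT (EFin \o (fun v => H p p v + H q q v)).
  exact: (integrableD measurableT (Hi _ _ ppf) (Hi _ _ qqf)).
have GE : G = (fun v => (H p q v + H q p v) - (H p p v + H q q v)).
  by apply/funext => v; rewrite /G /energy /H; ring.
have Gi : lambda.-integrable setT (EFin \o G).
  rewrite GE; exact: (integrableB measurableT Gi1 Gi2).
have D0' : fine (mean_dist p p) + fine (mean_dist q q) =
    fine (mean_dist p q) + fine (mean_dist q p).
  have F mu nu : (mean_dist mu nu < +oo)%E -> mean_dist mu nu = (fine (mean_dist mu nu))%:E.
    move=> fin; rewrite fineK// ge0_fin_numE//.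
    by apply: integral_ge0 => z _; rewrite lee_fin mdist_ge0.
  move: D0; rewrite (F _ _ ppf) (F _ _ qqf) (F _ _ pqf) (F _ _ qpf).
  by move=> /(congr1 fine)/= /eqP; rewrite subr_eq0 => /eqP.
have IG : (\int[lambda]_v (G v)%:E = 0)%E.
  rewrite -[LHS]fineK; last exact: integrable_fin_num.
  congr EFin; rewrite -/(Rintegral _ _ _) GE RintegralB// !RintegralD ?HE//; try exact: Hi.
  by rewrite -!mulrDl D0' subrr.
have : ae_eq lambda setT (EFin \o G) (cst 0%E).
  apply/ae_eq_integral_abs => //; first exact/measurable_EFinP.
  by under eq_integral do rewrite /= ger0_norm//.
apply: filterS => v /= /(_ I) [] /eqP.
by rewrite /G energy_mix// opprK mulf_eq0 gt_eqF ?expR_gt0//= => /eqP.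
Qed.

End mixture_energy.

(** * Polynomials converging to a step function *)

Section step_polynomials.
Context {R : realType}.
Implicit Types u x y : R.

Lemma bernoulli_ge x m : 0 <= x -> 1 + m%:R * x <= (1 + x) ^+ m.
Proof.
move=> x0; elim: m => [|m IH]; first by rewrite mul0r addr0 expr0.
rewrite exprS; apply: le_trans (_ : (1 + x) * (1 + m%:R * x) <= _).
  rewrite -natr1; have : 0 <= m%:R * x * x by rewrite !mulr_ge0.
  by lra.
by rewrite ler_wpM2l// addr_ge0.
Qed.

Lemma bernoulli_le x m : 0 <= x <= 1 -> 1 - m%:R * x <= (1 - x) ^+ m.
Proof.
move=> /andP[x0 x1]; elim: m => [|m IH]; first by rewrite mul0r subr0 expr0.
rewrite exprS; apply: le_trans (_ : (1 - x) * (1 - m%:R * x) <= _).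
  rewrite -natr1; have : 0 <= m%:R * x * x by rewrite !mulr_ge0.
  by lra.
by rewrite ler_wpM2l// subr_ge0.
Qed.

(** With [y] the square root of [x], Bernoulli's inequality bounds [n y^n], and
    the other factor [y^n] tends to [0]. *)
Lemma cvg_natmul_expr x : 0 <= x < 1 -> n%:R * x ^+ n @[n --> \oo] --> 0.
Proof.
move=> /andP[]; rewrite le_eqVlt => /predU1P[<- _|x0 x1].
  apply: cvg_near_cst; near=> n; rewrite expr0n gtn_eqF ?mulr0//.
  by near: n; exact: nbhs_infty_gt.
pose y := Num.sqrt x.
have y0 : 0 < y by rewrite sqrtr_gt0.
have y1 : y < 1 by rewrite -sqrtr1 ltr_sqrt.
pose h := y^-1 - 1.
have h0 : 0 < h by rewrite subr_gt0 invf_gt1.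
apply: (@squeeze_cvgr _ _ _ _ (fun=> 0) (fun n => y ^+ n / h)).
- near=> n; rewrite mulr_ge0 ?exprn_ge0 ?(ltW x0)//=.
  have -> : x = y * y by rewrite -expr2 sqr_sqrtr// ltW.
  rewrite exprMn mulrA mulrC ler_wpM2l ?exprn_ge0 ?(ltW y0)//.
  rewrite -[leRHS]mul1r ler_pdivlMr//.
  have := bernoulli_ge n (ltW h0); rewrite {2}/h addrCA subrr addr0 exprVn => b.
  rewrite mulrAC -ler_pdivlMr ?exprn_gt0// mul1r; apply: le_trans b.
  by rewrite lerDr.
- exact: cvg_cst.
- rewrite -(mul0r h^-1); apply: cvgMr_tmp.
  by apply: cvg_expr; rewrite ger0_norm// ltW.
Unshelve. all: by end_near. Qed.

(** With the exponent [2 ^ n] alone the limit at [1 / 2] would be [exp (- 1)]; the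
    extra factor [n] makes it [0], so that the limit is an indicator. *)
Definition step_poly n : {poly R} := (1 - 'X^n) ^+ (n * 2 ^ n).

Lemma step_polyE n u : (step_poly n).[u] = (1 - u ^+ n) ^+ (n * 2 ^ n).
Proof. by rewrite /step_poly horner_exp !hornerE. Qed.

Lemma step_poly01 n u : 0 <= u <= 1 -> 0 <= (step_poly n).[u] <= 1.
Proof.
move=> /andP[u0 u1]; rewrite step_polyE.
have un0 : 0 <= 1 - u ^+ n by rewrite subr_ge0 exprn_ile1.
by rewrite exprn_ge0//= exprn_ile1// gerBl exprn_ge0.
Qed.

(** With [m := n 2^n], the product [m u^n = n (2 u)^n] tends to [0] below [1 / 2]
    and is at least [n] from [1 / 2] on. Bernoulli's inequality gives the lower
    bound [1 - m u^n] in the first case, and in the second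
    [(1 - u^n)^m (1 + m u^n) <= ((1 - u^n) (1 + u^n))^m <= 1]. *)
Lemma cvg_step_poly u : 0 <= u <= 1 ->
  (step_poly n).[u] @[n --> \oo] --> ((u < 2^-1)%R%:R : R).
Proof.
move=> /andP[u0 u1]; have [uh|uh] := ltP u 2^-1.
  apply: (@squeeze_cvgr _ _ _ _ (fun n => 1 - n%:R * (2 * u) ^+ n) (fun=> 1)).
  - near=> n; have /andP[_ ->] := @step_poly01 n u (introT andP (conj u0 u1)).
    rewrite andbT step_polyE exprMn mulrA -natrX -natrM.
    by apply: bernoulli_le; rewrite exprn_ge0// exprn_ile1.
  - rewrite -[X in _ --> X]subr0; apply: cvgB; first exact: cvg_cst.
    by apply: cvg_natmul_expr; rewrite mulr_ge0//=; lra.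
  - exact: cvg_cst.
apply: (@squeeze_cvgr _ _ _ _ (fun=> 0) harmonic); last 2 first.
- exact: cvg_cst.
- exact: cvg_harmonic.
near=> n; have /andP[-> _] /= := @step_poly01 n u (introT andP (conj u0 u1)).
set m := (n * 2 ^ n)%N.
have un0 : 0 <= u ^+ n by rewrite exprn_ge0.
have un1 : u ^+ n <= 1 by rewrite exprn_ile1.
have nm : n%:R <= m%:R * u ^+ n.
  rewrite /m natrM natrX -mulrA -exprMn ler_peMr// exprn_ege1//.
  by lra.
rewrite step_polyE -/m -[leRHS]mul1r ler_pdivlMr ?ltr0n//.
apply: le_trans (_ : (1 - u ^+ n) ^+ m * (1 + u ^+ n) ^+ m <= 1); last first.
  rewrite -exprMn exprn_ile1//; first by rewrite mulr_ge0 ?subr_ge0// addr_ge0.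
  have : 0 <= u ^+ n * u ^+ n by rewrite mulr_ge0.
  by lra.
rewrite ler_wpM2l ?exprn_ge0 ?subr_ge0//.
by apply: le_trans (bernoulli_ge _ _) => //; rewrite -natr1 addrC lerD2l.
Unshelve. all: by end_near. Qed.

End step_polynomials.

(** * Gaussian functions determine measures *)

Section gauss_determining.
Context (R : realType) (T : pmetricType R).
Variable a : nat -> T.
Hypothesis a_dense : forall (x : T) e, 0 < e -> exists n, mdist x (a n) < e.
Hypothesis barycentre : forall s t (x y : T), 0 < s -> 0 < t -> exists z c, forall w,
  s * mdist x w ^+ 2 + t * mdist y w ^+ 2 = (s + t) * mdist z w ^+ 2 + c.

(** Gaussian functions are closed under products, up to constants. *)
Lemma gauss_mul s t (x y : T) : 0 <= s -> 0 <= t -> exists z C, forall w,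
  gauss s w x * gauss t w y = C * gauss (s + t) w z.
Proof.
rewrite le_eqVlt => /predU1P[<- _|s0].
  by exists y, 1 => w; rewrite {1}/gauss mul0r oppr0 expR0 add0r.
rewrite le_eqVlt => /predU1P[<-|t0].
  by exists x, 1 => w; rewrite {2}/gauss mul0r oppr0 expR0 addr0 mulr1 mul1r.
have [z [c zc]] := barycentre x y s0 t0.
exists z, (expR (- c)) => w; rewrite /gauss -!expRD; congr expR.
by rewrite !(metric_sym w) -!opprD zc addrC.
Qed.

Lemma gauss_expr s (x w : T) n : gauss s w x ^+ n = gauss (s *+ n) w x.
Proof. by rewrite /gauss -expRM_natl -[s *+ n]mulr_natl mulrN mulrA. Qed.

Variables p q : {finite_measure set (borel T) -> \bar R}.

(** The Gaussian factor is what lets the class of such [F] be stable under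
    multiplication by polynomials in a Gaussian function. *)
Definition gauss_agree (F : borel T -> R) := forall t z, 0 <= t ->
  \int[p]_x (F x * gauss t (x : T) z) = \int[q]_x (F x * gauss t (x : T) z).

Lemma gauss_agree_poly F s x (P : {poly R}) : bmeas F -> 0 <= s ->
  gauss_agree F -> gauss_agree (fun w => F w * P.[gauss s (w : T) x]).
Proof.
move=> bF s0 FG t z t0.
have bG i : bmeas (fun w : borel T => F w * P`_i * (gauss s (w : T) x ^+ i * gauss t (w : T) z)).
  apply: bmeasM; first by apply: bmeasM => //; exact: bmeas_cst.
  apply: bmeasM; last exact: bmeas_gauss.
  under eq_fun do rewrite gauss_expr.
  by apply: bmeas_gauss; rewrite mulrn_wge0.
have E (mu : {finite_measure set (borel T) -> \bar R}) :
    \int[mu]_w (F w * P.[gauss s (w : T) x] * gauss t (w : T) z) =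
    \sum_(i < size P) \int[mu]_w (F w * P`_i * (gauss s (w : T) x ^+ i * gauss t (w : T) z)).
  rewrite -Rintegral_sum => [|i]; last exact: bmeas_integrable (finite_measure_lty mu) (bG i).
  apply: eq_Rintegral => w _; rewrite horner_coef mulr_sumr mulr_suml.
  by apply: eq_bigr => i _; rewrite !mulrA.
rewrite !E; apply: eq_bigr => i _.
have [y [C yC]] := gauss_mul x z (mulrn_wge0 i s0) t0.
have E' (mu : {finite_measure set (borel T) -> \bar R}) :
    \int[mu]_w (F w * P`_i * (gauss s (w : T) x ^+ i * gauss t (w : T) z)) =
    P`_i * C * \int[mu]_w (F w * gauss (s *+ i + t) (w : T) y).
  rewrite -RintegralZl//; last first.
    apply: bmeas_integrable; first exact: finite_measure_lty.
    apply: bmeasM => //.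
    by apply: bmeas_gauss; rewrite addr_ge0// mulrn_wge0.
  by apply: eq_Rintegral => w _; rewrite gauss_expr yC; ring.
by rewrite !E' FG// addr_ge0// mulrn_wge0.
Qed.

Lemma bmeas_gauss_agree_cvg (F : (borel T -> R) ^nat) G :
  (forall n, bmeas (F n)) -> (forall n x, `|F n x| <= 1) ->
  (forall x, F n x @[n --> \oo] --> G x) ->
  (forall n, gauss_agree (F n)) -> gauss_agree G.
Proof.
move=> bF F1 FG Fag t z t0.
have cv (mu : {finite_measure set (borel T) -> \bar R}) :
    \int[mu]_x (F n x * gauss t (x : T) z) @[n --> \oo] --> \int[mu]_x (G x * gauss t (x : T) z).
  apply: (@Rintegral_dct _ _ _ _ _ _ (fun=> 1)).
  - by move=> n; have [] := bmeasM (bF n) (bmeas_gauss z t0).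
  - by move=> x; apply: cvgMr_tmp; exact: FG.
  - by apply: bmeas_integrable; [exact: finite_measure_lty|exact: bmeas_cst].
  - by move=> n x; rewrite normrM mulr_ile1 ?normr_gauss.
have := cv p; rewrite (_ : (fun n => _) = fun n => \int[q]_x (F n x * gauss t (x : T) z)).
  by move=> cp; exact: (cvg_unique _ cp (cv q)).
by apply/funext => n; exact: Fag.
Qed.

(** The scale [s] puts the value [1 / 2] of the Gaussian function centred at [c] on
    the sphere of radius [r], where the step polynomials jump. *)
Lemma gauss_agree_ballC F c r : bmeas F -> (forall x, `|F x| <= 1) -> 0 < r ->
  gauss_agree F -> gauss_agree (fun x => F x * (r < mdist (x : T) c)%R%:R).
Proof.
move=> bF F1 r0 FG.
pose s : R := ln 2 / r ^+ 2.
have s0 : 0 < s by rewrite divr_gt0 ?exprn_gt0// ln_gt0 ?ltr1n.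
have lt_half (x : T) : (gauss s x c < 2^-1) = (r < mdist x c).
  rewrite /gauss -[X in _ < X^-1](@lnK R) ?posrE// -expRN ltr_expR ltrN2.
  rewrite mulrAC ltr_pdivlMr ?exprn_gt0// ltr_pM2l ?ln_gt0 ?ltr1n//.
  by rewrite ltr_pXn2r// nnegrE ?mdist_ge0// ltW.
have g01 (x : T) : 0 <= gauss s x c <= 1 by rewrite gauss_ge0 gauss_le1// ltW.
apply: (@bmeas_gauss_agree_cvg (fun n x => F x * (step_poly n).[gauss s (x : T) c])).
- move=> n; apply: bmeasM => //; split.
    under eq_fun do rewrite step_polyE.
    apply: measurable_funX; apply: measurable_funB => //; apply: measurable_funX.
    exact: (bmeas_gauss c (ltW s0)).1.
  exists 1 => x; have /andP[? ?] := step_poly01 n (g01 x).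
  by rewrite ger0_norm.
- move=> n x; rewrite normrM mulr_ile1//.
  by have /andP[? ?] := step_poly01 n (g01 x); rewrite ger0_norm.
- by move=> x; rewrite -lt_half; apply: cvgMl_tmp; exact: cvg_step_poly.
- by move=> n; apply: gauss_agree_poly => //; exact: ltW.
Qed.

Lemma bmeas_ballC c r : bmeas (fun x : borel T => (r < mdist (x : T) c)%R%:R : R).
Proof.
have -> : (fun x : borel T => (r < mdist (x : T) c)%R%:R : R) =
   \1_((fun x : borel T => mdist (x : T) c) @^-1` `]r, +oo[%classic).
  apply/funext => x; rewrite indicE; congr (nat_of_bool _)%:R.
  by apply/idP/idP; rewrite inE/= in_itv/= andbT.
apply: bmeas_indic; rewrite -[X in measurable X]setTI.
by apply: (measurable_mdistl c).
Qed.

(** The pair [(n, k)] stands for the closed ball of centre [a n] and radius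
    [1 / (k + 1)]; countably many such balls cover an open set. *)
Definition ball_in (U : set T) (nk : nat * nat) :=
  forall y, mdist y (a nk.1) <= nk.2.+1%:R^-1 -> U y.

(** The indicator of the complement of the ball coded by [m] when this ball lies
    in [U], and [1] for all other codes; the product over [m] is then the
    indicator of the complement of [U]. *)
Definition avoid (U : set T) m (x : borel T) : R :=
  if unpickle m is Some nk then
    if `[< ball_in U nk >] then (nk.2.+1%:R^-1 < mdist (x : T) (a nk.1))%R%:R
    else 1
  else 1.

Lemma avoid_cvg (U : set T) x : open U ->
  \prod_(m < n) avoid U m x @[n --> \oo] --> (\1_(~` U) x : R).
Proof.
move=> oU; rewrite indicE in_setC; have [xU|xU] := pselect (U x); last first.
  rewrite memNset//=; apply: cvg_near_cst; apply: nearW => n.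
  rewrite big1// => m _; rewrite /avoid; case: unpickle => [nk|] //.
  by case: asboolP => // g; case: ltP => // /g /xU.
rewrite mem_set//=; apply: cvg_near_cst.
have : nbhs x U by move: oU; rewrite openE => /(_ _ xU).
rewrite -nbhs_ballE => -[e /= e0 eU].
have [k ke] : exists k, k.+1%:R^-1 < e / 2.
  have e20 : 0 < e / 2 by rewrite divr_gt0.
  have /cvgrPdist_lt /(_ _ e20) [k _ /(_ k (leqnn k))] := @cvg_harmonic R.
  by rewrite sub0r normrN ger0_norm ?invr_ge0//; exists k.
have k0 : 0 < k.+1%:R^-1 :> R by rewrite invr_gt0.
have [i xi] := a_dense x k0.
have gik : ball_in U (i, k).
  move=> y /= yi; apply: eU; rewrite ballE/=.
  apply: le_lt_trans (metric_triangle x (a i) y) _.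
  by rewrite (metric_sym (a i)) (splitr e) ltrD// ?(lt_trans xi ke)// (le_lt_trans yi ke).
near=> n; have mn : (pickle (i, k) < n)%N by near: n; exact: nbhs_infty_gt.
rewrite (bigD1 (Ordinal mn))//= [avoid _ _ _](_ : _ = 0) ?mul0r//.
by rewrite /avoid pickleK asboolT//= ltNge (ltW xi).
Unshelve. all: by end_near. Qed.

Lemma open_agree (U : set T) : gauss_agree (fun=> 1) -> open U ->
  p (U : set (borel T)) = q U.
Proof.
move=> G1 oU.
have C01 m x : avoid U m x = 0 \/ avoid U m x = 1.
  rewrite /avoid; case: unpickle => [nk|]; last by right.
  by case: asboolP => _; [case: ltP; [right|left]|right].
have C1 m x : `|avoid U m x| <= 1.
  by have [->|->] := C01 m x; rewrite ?normr0 ?normr1.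
have bC m : bmeas (avoid U m).
  rewrite /avoid; case: unpickle => [nk|]; last exact: bmeas_cst.
  by case: asboolP => _; [exact: bmeas_ballC|exact: bmeas_cst].
pose F n (x : borel T) := \prod_(m < n) avoid U m x.
have F1 n x : `|F n x| <= 1.
  by rewrite /F normr_prod; apply: prodr_ile1 => m _; rewrite normr_ge0/=.
have bF n : bmeas (F n).
  split; last by exists 1; exact: F1.
  by apply: measurable_prod => m _; exact: (bC m).1.
have FA n : gauss_agree (F n).
  elim: n => [|n IH].
    by have -> : F 0%N = fun=> 1 by apply/funext => x; rewrite /F big_ord0.
  have -> : F n.+1 = fun x => F n x * avoid U n x.
    by apply/funext => x; rewrite /F big_ord_recr.
  have FE : (fun x => F n x * 1) = F n by apply/funext => x; rewrite mulr1.
  rewrite /avoid; case: unpickle => [nk|]; last by rewrite FE.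
  case: asboolP => _; last by rewrite FE.
  by apply: gauss_agree_ballC => //; rewrite invr_gt0.
have UA : gauss_agree (\1_(~` U)).
  by apply: (bmeas_gauss_agree_cvg bF F1 _ FA) => x; exact: avoid_cvg.
have mU : measurable (U : set (borel T)) by exact: open_measurable_borel.
(* The scale [0] stands for the constant function [1], with any centre. *)
have E (mu : {finite_measure set (borel T) -> \bar R}) : mu U =
    (\int[mu]_x (1 * gauss 0 (x : T) point) -
     \int[mu]_x (\1_(~` U) x * gauss 0 (x : T) point))%:E.
  rewrite -RintegralB//; last 2 first.
  - apply: bmeas_integrable; first exact: finite_measure_lty.
    by apply: bmeasM; [exact: bmeas_cst|exact: bmeas_gauss].
  - apply: bmeas_integrable; first exact: finite_measure_lty.
    by apply: bmeasM; [apply: bmeas_indic; exact: measurableC|exact: bmeas_gauss].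
  rewrite (_ : (fun x => _) = \1_(U : set (borel T))); last first.
    apply/funext => x; rewrite /gauss mul0r oppr0 expR0 !mulr1 !indicE in_setC.
    by case: (x \in U); rewrite ?subr0 ?subrr.
  rewrite /Rintegral integral_indic// setIT fineK//; exact: fin_num_measure.
by rewrite (E p) (E q) UA// G1.
Qed.

Lemma gauss_determining : gauss_agree (fun=> 1) ->
  forall A : set (borel T), measurable A -> p A = q A.
Proof.
move=> G1; apply: (@measure_unique _ _ (borel T) open (fun=> setT)) => //.
- exact: openI.
- by move=> _; exact: openT.
- by rewrite bigcup_const.
- by move=> U oU; exact: open_agree.
- by move=> _; exact: finite_measure_lty.
Qed.

End gauss_determining.

(** * Jordan parts and first moments *)

Section jordan_parts.
Context d (T : measurableType d) (R : realType).
Local Open Scope ereal_scope.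

Lemma sube_eq0 (x y : \bar R) : y \is a fin_num -> x - y = 0 -> x = y.
Proof. by move=> yfin xy; rewrite -[x](subeK _ yfin) xy add0e. Qed.

Lemma charge_posE (nu : {charge set T -> \bar R}) A : measurable A ->
  charge_pos nu A = nu (A `&` hahn_pos nu).
Proof.
move=> mA; rewrite /charge_pos/= jordan_posE cjordan_posE /crestr0 mem_set//.
Qed.

Lemma charge_negE (nu : {charge set T -> \bar R}) A : measurable A ->
  charge_neg nu A = - nu (A `&` hahn_neg nu).
Proof.
move=> mA; rewrite /charge_neg/= jordan_negE cjordan_negE /crestr0 mem_set//.
Qed.

Lemma charge_decomp (nu : {charge set T -> \bar R}) A : measurable A ->
  nu A = charge_pos nu A - charge_neg nu A.
Proof.
by move=> mA; rewrite (jordan_decomp (hahn_posneg nu) mA) /cadd/= /cscale/= mulN1e.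
Qed.

Variables mu1 mu2 : probability T R.
Local Notation nu := (probability_diff mu1 mu2).

Lemma probability_diffE A : nu A = mu1 A - mu2 A.
Proof. by []. Qed.

(** On a set where [mu1 - mu2] is positive, subtracting [mu2] only lowers [mu1];
    this is how the Jordan parts inherit first moments from [mu1] and [mu2]. *)
Lemma charge_pos_le A : measurable A -> charge_pos nu A <= mu1 A.
Proof.
move=> mA; have [[mP _] _ _ _] := hahn_posneg nu.
rewrite charge_posE// probability_diffE.
apply: (@le_trans _ _ (mu1 (A `&` hahn_pos nu))).
  by rewrite leeBlDr ?fin_num_measure//; [rewrite leeDl|exact: measurableI].
by apply: le_measure; rewrite ?inE//; exact: measurableI.
Qed.

Lemma charge_neg_le A : measurable A -> charge_neg nu A <= mu2 A.
Proof.
move=> mA; have [_ [mN _] _ _] := hahn_posneg nu.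
have mAN : measurable (A `&` hahn_neg nu) by exact: measurableI.
rewrite charge_negE// probability_diffE.
rewrite fin_num_oppeB ?fin_num_measure//.
apply: (@le_trans _ _ (mu2 (A `&` hahn_neg nu))).
  by rewrite addeC leeBlDr ?fin_num_measure// leeDl.
by apply: le_measure; rewrite ?inE.
Qed.

Lemma charge_mass :
  (\int[charge_pos nu]_x 1 = \int[charge_neg nu]_x 1 :> R)%R.
Proof.
have := charge_decomp nu measurableT.
rewrite probability_diffE !probability_setT subee// => /esym e.
by rewrite !Rintegral_cst//= (sube_eq0 _ e)// fin_num_measure.
Qed.

Lemma same_measure_charge_parts :
  (forall A, measurable A -> charge_pos nu A = charge_neg nu A) ->
  same_measure mu1 mu2.
Proof.
move=> e A mA; have := charge_decomp nu mA.
rewrite e// subee ?fin_num_measure// probability_diffE.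
by move/sube_eq0; apply; exact: fin_num_measure.
Qed.

Lemma same_measure_null : same_measure mu1 mu2 ->
  forall A, measurable A -> charge_pos nu A = 0 /\ charge_neg nu A = 0.
Proof.
move=> mu12 A mA; have [[mP _] [mN _] _ _] := hahn_posneg nu.
rewrite charge_posE// charge_negE// !probability_diffE.
by rewrite !mu12 ?subee ?oppe0 ?fin_num_measure//; exact: measurableI.
Qed.

End jordan_parts.

Section moments.
Context (R : realType) (T : pmetricType R).
Variable a : nat -> T.
Hypothesis a_dense : forall (x : T) e, (0 < e)%R -> exists n, (mdist x (a n) < e)%R.
Implicit Types (mu nu : {finite_measure set (borel T) -> \bar R}).
Local Open Scope ereal_scope.

Definition moment mu o := \int[mu]_(x in setT) (mdist (x : T) o)%:E.

Lemma moment_lty mu o o' : moment mu o < +oo -> moment mu o' < +oo.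
Proof.
move=> fin; apply: (@le_lt_trans _ _ (\int[mu]_x ((mdist (x : T) o)%:E + (mdist o o')%:E))).
  apply: ge0_le_integral => //=.
  - by move=> x _; rewrite lee_fin mdist_ge0.
  - by apply/measurable_EFinP; exact: measurable_mdistl.
  - by apply: emeasurable_funD => //; apply/measurable_EFinP; exact: measurable_mdistl.
  - by move=> x _; rewrite -EFinD lee_fin metric_triangle.
rewrite ge0_integralD//=.
- rewrite lte_add_pinfty// integral_cst//.
  by rewrite lte_mul_pinfty ?lee_fin ?mdist_ge0// finite_measure_lty.
- by move=> x _; rewrite lee_fin mdist_ge0.
- by apply/measurable_EFinP; exact: measurable_mdistl.
- by move=> x _; rewrite lee_fin mdist_ge0.
Qed.

(** By the triangle inequality through [o]. *)
Lemma mean_dist_lty mu nu o : moment mu o < +oo -> moment nu o < +oo ->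
  mean_dist mu nu < +oo.
Proof.
move=> muo nuo; rewrite /mean_dist fubini_tonelli1//=; last 2 first.
- by apply/measurable_EFinP; exact: measurable_mdist a_dense.
- by move=> z; rewrite lee_fin mdist_ge0.
have mo : measurable_fun [set: borel T] (fun x : borel T => (mdist (x : T) o)%:E).
  by apply/measurable_EFinP; exact: measurable_mdistl.
have mo0 (x : borel T) : 0 <= (mdist (x : T) o)%:E by rewrite lee_fin mdist_ge0.
apply: (@le_lt_trans _ _ (\int[mu]_x ((mdist (x : T) o)%:E * nu setT + moment nu o))).
  apply: ge0_le_integral => //=.
  - by move=> x _; apply: integral_ge0 => y _; rewrite lee_fin mdist_ge0.
  - apply: measurable_fun_fubini_tonelli_F => //=.
      by apply/measurable_EFinP; exact: measurable_mdist a_dense.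
    by move=> z; rewrite lee_fin mdist_ge0.
  - by apply: emeasurable_funD => //; exact: emeasurable_funM.
  - move=> x _; rewrite -integral_cst// -ge0_integralD//=.
    apply: ge0_le_integral => //=.
    + by move=> y _; rewrite lee_fin mdist_ge0.
    + apply/measurable_EFinP.
      have := @measurable_mdistl R T x; congr (measurable_fun _ _).
      by apply/funext => y; exact: metric_sym.
    + exact: emeasurable_funD.
    + by move=> y _; rewrite -EFinD lee_fin [mdist y o]metric_sym metric_triangle.
rewrite ge0_integralD//=; last 3 first.
- by move=> x _; rewrite mule_ge0.
- exact: emeasurable_funM.
- by move=> x _; apply: integral_ge0 => y _.
rewrite lte_add_pinfty//.
  rewrite ge0_integralZr// lte_mul_pinfty ?finite_measure_lty//.
    exact: integral_ge0.
  by rewrite ge0_fin_numE//; exact: integral_ge0.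
rewrite integral_cst// lte_mul_pinfty ?finite_measure_lty//.
  exact: integral_ge0.
by rewrite ge0_fin_numE//; exact: integral_ge0.
Qed.

End moments.

(** * Strong negative type of Gaussian metric spaces *)

Section ae_dense.
Context (R : realType).

Lemma ae_lebesgue_dense (P : R -> Prop) : {ae @lebesgue_measure R, forall v, P v} ->
  forall v e, 0 < e -> exists2 w, P w & v < w < v + e.
Proof.
move=> aeP v e e0; apply: contrapT => nP.
have nvw : (@lebesgue_measure R).-negligible `]v, v + e[%classic.
  apply: negligibleS aeP => w /=; rewrite in_itv/= => vw Pw.
  by apply: nP; exists w.
have : @lebesgue_measure R `]v, v + e[%classic = 0%E.
  by apply/negligibleP => //; exact: measurable_itv.
rewrite lebesgue_measure_itv/= lte_fin ltrDl e0 -EFinB => -[].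
by rewrite addrC addKr => e00; rewrite e00 ltxx in e0.
Qed.

End ae_dense.

Section strong_negative_type.
Context (R : realType) (T : pmetricType R).
Variable a : nat -> T.
Hypothesis a_dense : forall (x : T) e, 0 < e -> exists n, mdist x (a n) < e.
Hypothesis gauss_psd : forall t, 0 <= t -> psd (@gauss R T t).
Hypothesis barycentre : forall s t (x y : T), 0 < s -> 0 < t -> exists z c, forall w,
  s * mdist x w ^+ 2 + t * mdist y w ^+ 2 = (s + t) * mdist z w ^+ 2 + c.

Lemma cvg_gauss_integral (mu : {finite_measure set (borel T) -> \bar R}) (v : R) (w : R^nat) z :
  w n @[n --> \oo] --> v ->
  \int[mu]_x gauss (expR (2 * w n)) (x : T) z @[n --> \oo] -->
  \int[mu]_x gauss (expR (2 * v)) (x : T) z.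
Proof.
move=> wv; apply: (@Rintegral_dct _ _ _ _ _ _ (fun=> 1)).
- by move=> n; apply: (bmeas_gauss z _).1; exact: expR_ge0.
- move=> x; rewrite /gauss; apply: continuous_cvg; first exact: continuous_expR.
  apply: cvgN; apply: cvgMr_tmp; apply: continuous_cvg; first exact: continuous_expR.
  by apply: cvgMl_tmp.
- by apply: bmeas_integrable; [exact: finite_measure_lty|exact: bmeas_cst].
- by move=> n x; apply: normr_gauss; exact: expR_ge0.
Qed.

(** Almost every scale is good, hence a dense set of scales, and both integrals
    are continuous in the scale. *)
Lemma gauss_agree1 (p q : {finite_measure set (borel T) -> \bar R}) :
  \int[p]_x 1 = \int[q]_x 1 ->
  {ae @lebesgue_measure R, forall v,
    energy p q (fun z => gauss (expR (2 * v)) (z.1 : T) z.2) = 0} ->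
  gauss_agree p q (fun=> 1).
Proof.
move=> pq1 aeE t z; rewrite le_eqVlt => /predU1P[<-|t0].
  have g0 (mu : {finite_measure set (borel T) -> \bar R}) :
      \int[mu]_x (1 * gauss 0 (x : T) z) = \int[mu]_x 1.
    by apply: eq_Rintegral => x _; rewrite /gauss mul0r oppr0 expR0 mulr1.
  by rewrite !g0.
under eq_Rintegral do rewrite mul1r.
under [RHS]eq_Rintegral do rewrite mul1r.
pose v := ln t / 2.
have tv : t = expR (2 * v) by rewrite /v mulrCA divff// mulr1 lnK.
have w_ n : {w | energy p q (fun z => gauss (expR (2 * w)) (z.1 : T) z.2) = 0 &
    v < w < v + n.+1%:R^-1}.
  by apply: cid2; apply: (ae_lebesgue_dense aeE); rewrite invr_gt0.
pose w n := s2val (w_ n).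
have wv : w n @[n --> \oo] --> v.
  apply: (@squeeze_cvgr _ _ _ _ (fun=> v) (fun n => v + n.+1%:R^-1)).
  - by apply: nearW => n; rewrite /w; case: (w_ n) => /= ? _ /andP[/ltW -> /ltW ->].
  - exact: cvg_cst.
  - rewrite -[X in _ --> X]addr0; apply: cvgD; first exact: cvg_cst.
    exact: cvg_harmonic.
rewrite tv.
have cp := @cvg_gauss_integral p v w z wv.
have cq := @cvg_gauss_integral q v w z wv.
have pq : (fun n => \int[p]_x gauss (expR (2 * w n)) (x : T) z) =
    (fun n => \int[q]_x gauss (expR (2 * w n)) (x : T) z).
  apply/funext => n; apply: (energy_gauss_eq0 a_dense gauss_psd); first exact: expR_ge0.
  by rewrite /w; case: (w_ n).
by rewrite pq in cp; exact: (cvg_unique _ cp cq).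
Qed.

Lemma gauss_strong_negative_type : strong_negative_type T.
Proof.
split; first exact: gauss_negative_type.
move=> mu1 mu2 [y1 fin1] [y2 fin2].
set nu := probability_diff mu1 mu2.
have mm o : measurable_fun [set: borel T] (fun x : borel T => (mdist (x : T) o)%:E).
  by apply/measurable_EFinP; exact: measurable_mdistl.
split=> [D0|mu12].
  apply: same_measure_charge_parts => A mA.
  have finp : (moment (charge_pos nu) y1 < +oo)%E.
    apply: le_lt_trans fin1; apply: ge0_le_measure_integral => //.
      by move=> B mB; exact: charge_pos_le.
    by move=> x; rewrite lee_fin mdist_ge0.
  have finq : (moment (charge_neg nu) y1 < +oo)%E.
    apply: (@moment_lty _ _ _ y2).
    apply: le_lt_trans fin2; apply: ge0_le_measure_integral => //.
      by move=> B mB; exact: charge_neg_le.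
    by move=> x; rewrite lee_fin mdist_ge0.
  apply: (@gauss_determining _ _ _ a_dense barycentre (charge_pos nu) (charge_neg nu)) => //.
  apply: gauss_agree1; first exact: charge_mass.
  apply: (ae_energy_gauss_eq0 a_dense gauss_psd) => //; first exact: charge_mass.
  - exact (mean_dist_lty a_dense finp finp).
  - exact (mean_dist_lty a_dense finq finq).
  - exact (mean_dist_lty a_dense finp finq).
  - exact (mean_dist_lty a_dense finq finp).
rewrite /D /integral_charge_sqr.
have null (m n : {finite_measure set (borel T) -> \bar R}) : m setT = 0%E ->
   (\int[(m \x n)%E]_z (mdist (z.1 : T) z.2)%:E = 0)%E.
  move=> m0.
  rewrite -[RHS](integral_measure_zero setT
    (fun z : borel T * borel T => (mdist (z.1 : T) z.2)%:E)).
  apply: eq_measure_integral => A mA _.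
  apply/eqP; rewrite -measure_le0 -(mul0e (n setT)) -m0 -product_measure1E// setXTT.
  by apply: le_measure; rewrite ?inE.
have [p0 q0] := same_measure_null mu12 measurableT.
by rewrite !null// !adde0 sube0.
Qed.

End strong_negative_type.

(** * Hilbert spaces *)

Lemma separable_dense_seq (K : numFieldType) (V : normedModType K) :
  separable V -> exists a : nat -> V, forall x e, 0 < e -> exists n, `|x - a n| < e.
Proof.
move=> [A /countable_injP[f fi] dA].
pose a n := if pselect (exists2 y, A y & f y = n) is left h then s2val (cid2 h) else 0.
exists a => x e e0.
have [||y [xy Ay]] := dA (ball x e).
- by exists x; exact: ballxx.
- exact: ball_open.
exists (f y); rewrite /a; case: pselect => [h|[]]; last by exists y.
case: cid2 => /= z Az fz.
by rewrite (fi z y)// ?inE//; move: xy; rewrite -ball_normE.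
Qed.

(** The map [f] pulls the inner product back to [T], and [g] brings barycentres
    back to [T]. *)
Lemma inner_product_strong_negative_type (R : realType) (T : pmetricType R)
    (V : zmodType) (sc : R -> V -> V) (ip : V -> V -> R) (f : T -> V) (g : V -> T) :
  real_inner sc ip -> cancel g f ->
  (forall x y, mdist x y ^+ 2 = ip (f x - f y) (f x - f y)) ->
  (exists a : nat -> T, forall x e, 0 < e -> exists n, mdist x (a n) < e) ->
  strong_negative_type T.
Proof.
move=> ipP gf dE [a a_dense]; apply: (gauss_strong_negative_type a_dense).
  move=> t t0 n x c; under eq_bigr do under eq_bigr do rewrite /gauss dE.
  exact: (psd_gauss_ip ipP t0 (fun i => f (x i))).
move=> s t x y s0 t0; have [z [c zc]] := ip_barycentre ipP (f x) (f y) s0 t0.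
by exists (g z), c => w; rewrite !dE gf zc.
Qed.

Theorem theorem3p27 (R : realType) :
  (forall (V : completeNormedModType R) (dot : {dot V for idfun}),
     induces_norm dot -> separable V ->
     strong_negative_type (real_metric V)) /\
  (forall (V : completeNormedModType R[i]) (dot : {dot V for Num.conj}),
     induces_norm dot -> separable V ->
     strong_negative_type (complex_metric V)).
Proof.
split=> V dot dotN sepV.
  have ipP : real_inner (fun c (x : V) => c *: x) (fun x y => dot x y : R).
    split.
    - by move=> x y; rewrite hermC/= expr0 mul1r.
    - by move=> x y z; rewrite linearDl.
    - by move=> c x y; rewrite linearZl_LR.
    - by move=> x; rewrite -dotN exprn_ge0.
    - move=> x; rewrite -dotN => /eqP.
      by rewrite sqrf_eq0 normr_eq0 => /eqP.
  apply: (@inner_product_strong_negative_type _ (real_metric V) V _ _ id id ipP) => //.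
  - by move=> x y; rewrite real_mdistE dotN.
  - have [a aP] := separable_dense_seq sepV; exists a => x e e0.
    exact: aP.
have ipP : real_inner (fun c (x : V) => c%:C%C *: x) (fun x y => complex.Re (dot x y)).
  split.
  - by move=> x y; rewrite hermC/= expr0 mul1r; case: (dot y x).
  - by move=> x y z; rewrite linearDl raddfD.
  - move=> c x y; rewrite linearZl_LR/=.
    by case: (dot x y) => u v /=; rewrite mul0r subr0.
  - move=> x; rewrite -dotN -(RRe_real (normr_real x)) -rmorphXn/= exprn_ge0//.
    by rewrite -lecR RRe_real// normr_ge0.
  - move=> x; rewrite -dotN.
    rewrite -(RRe_real (normr_real x)) -rmorphXn/= => /eqP; rewrite sqrf_eq0 => /eqP e.
    by apply/normr0_eq0; rewrite -(RRe_real (normr_real x)) e.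
apply: (@inner_product_strong_negative_type _ (complex_metric V) V _ _ id id ipP) => //.
- by move=> x y; rewrite -dotN -complex_mdistE -rmorphXn.
- have [a aP] := separable_dense_seq sepV; exists a => x e e0.
  have [n xn] := aP x e%:C%C ltac:(by rewrite ltcR).
  by exists n; rewrite -ltcR complex_mdistE.
Qed.
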